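(* Let $\varepsilon>0$. There exists $n_0(\varepsilon)$ such that for every $n\ge n_0(\varepsilon)$, $$\frac{n}{(\log n)^{2+\varepsilon}}<n-F_{4,3}(n)\le n-f_{4,3}(n)<\frac{n}{(\log n)^{1-\frac{e\log 3}{2\sqrt{3}}-\varepsilon}}.$$
   Context: $\log$ is the natural logarithm. For integers $k\ge2$, $d\ge2$, $n\ge1$: $F_{k,d}(n)$ is the maximal size of a set $A\subseteq\{1,\dots,n\}$ such that $a_1a_2\cdots a_k=x^d$ with $a_1<\dots<a_k$ has no solution with $a_i\in A$ and $x$ an integer; $f_{k,d}(n)$ is the maximal size of a set $A\subseteq\{1,\dots,n\}$ such that $a_1\cdots a_k=x^d$ (with $a_i\in A$ not necessarily distinct, $x$ an integer) has no solution except trivial ones, a solution being trivial if the multiset $\{a_1,\dots,a_k\}$ can be partitioned into $d$-element sub-multisets each consisting of $d$ copies of the same number (for $k=4,d=3$ no trivial solutions exist). *)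

(* Defs.v *)
From mathcomp Require Import all_boot all_order all_algebra.
From mathcomp Require Import boolp.

Set Implicit Arguments.
Unset Strict Implicit.
Unset Printing Implicit Defensive.

Import GRing.Theory.

Definition dth_power (d m : nat) : Prop := exists x : int, (Posz m = x ^+ d)%R.

(* Subsets of {1, ..., n} are represented as sets A : {set 'I_n.+1} with
   ord0 \notin A, so that an element of A is the integer it stands for. *)

Definition no_increasing_solution (k d n : nat) (A : {set 'I_n.+1}) : Prop :=
  forall a : 'I_k -> 'I_n.+1,
    (forall i, a i \in A) ->
    (forall i j : 'I_k, i < j -> a i < a j) ->
    ~ dth_power d (\prod_(i < k) a i).

(* A partition of the multiset {a_1, ..., a_k} into sub-multisets is a partition
   of its index set 'I_k. *)
Definition trivial_solution (k d n : nat) (a : 'I_k -> 'I_n.+1) : Prop :=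
  exists P : {set {set 'I_k}},
    partition P [set: 'I_k] /\
    (forall B, B \in P -> #|B| = d /\ {in B &, forall i j, a i = a j}).

Definition only_trivial_solutions (k d n : nat) (A : {set 'I_n.+1}) : Prop :=
  forall a : 'I_k -> 'I_n.+1,
    (forall i, a i \in A) ->
    dth_power d (\prod_(i < k) a i) ->
    trivial_solution d a.

Definition F (k d n : nat) : nat :=
  \max_(A : {set 'I_n.+1} | (ord0 \notin A) && `[< no_increasing_solution k d A >])
    #|A|.

Definition f (k d n : nat) : nat :=
  \max_(A : {set 'I_n.+1} | (ord0 \notin A) && `[< only_trivial_solutions k d A >])
    #|A|.

(* Main.v *)
(**
   Write f * g for Dirichlet convolution and tau_k for the k-fold divisor
   function; tau_k is submultiplicative, so the k-fold convolution of 1/tau_k is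
   at most 1.

   If a_1, ..., a_4 are squarefree and their product is a cube, then every prime
   divides exactly three of them or none, whence
   (a_1, a_2, a_3, a_4) = (BCD, ACD, ABD, ABC); conversely such products have
   product (ABCD)^3.

   Removing few integers leaves a solution: give (A, B, C, D) in [1, n^(1/3)]^4
   the weight f(A)f(B)f(C)f(D) with f = 1/tau_3.  As f * f * f <= 1, an integer
   a is BCD with total weight at most 1, so the removed set E satisfies
   S^3 <= 8 #E, where S = sum_(m <= n^(1/3)) f(m).  Comparing f * f * f = 1 on
   squarefree numbers with the harmonic sum and using Chebyshev's bound gives
   S >> n^(1/3) (log n)^(-2/3), so #E >> n / (log n)^2.

   Removing suitable integers destroys all solutions: discard a if a < n/log n,
   if a has a large square divisor, if tau_2(a) >= T = (log n)^(5/4), or if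
   a = rBCD with r <= (log n)^O(1) and B, C, D coprime, squarefree and within
   (log n)^O(1) of n^(1/3).  The third class has at most n (log n)/T members.
   With f = 1/tau_2, the last one has at most T sum f(B)f(C)f(D) members outside
   the third; since f * f <= 1, Chebyshev's bound gives
   sum_(m <= x) f(m) << x / sqrt(log x), so this is
   n T (log n)^(-3/2) (log log n)^O(1).  Both are n (log n)^(-1/4+o(1)), while
   1 - e log 3 / (2 sqrt 3) = 0.137... < 1/5.
*)

Require Import Defs.
From mathcomp Require Import all_boot all_order all_algebra.
From mathcomp Require Import reals sequences exp.
From mathcomp Require Import boolp zify ring lra.

Import Order.TTheory GRing.Theory Num.Theory.
Local Open Scope nat_scope.

(** * Divisor functions, squarefree numbers and primorials *)

(* The number of ordered factorizations of [m] into [k.+1] factors, so that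
   [tau 1] is the usual divisor function. *)
Fixpoint tau (k m : nat) : nat :=
  if k is k'.+1 then \sum_(d <- divisors m) tau k' d else 1.

Definition squarefree (m : nat) : bool := all (fun p => logn p m <= 1) (primes m).

(** The logarithm of [primorial n] is Chebyshev's theta function at [n]. *)
Definition primorial (n : nat) : nat := \prod_(1 <= p < n.+1 | prime p) p.

Lemma tau1E m : tau 1 m = size (divisors m).
Proof. by rewrite /= sum1_size. Qed.

Lemma divisorsP d m : 0 < m -> d \in divisors m -> (0 < d) /\ d %| m.
Proof.
by move=> m0; rewrite -dvdn_divisors // => dm; split=> //; apply: dvdn_gt0 dm.
Qed.

Lemma tau_gt0 k m : 0 < m -> 0 < tau k m.
Proof.
elim: k m => [//|k IH] m m0 /=.
have d1 : 1 \in divisors m by rewrite -dvdn_divisors.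
by rewrite (big_rem 1 d1) /= addn_gt0 IH.
Qed.

Lemma leq_sum_subset (T : eqType) (s t : seq T) (g : T -> nat) :
  uniq s -> {subset s <= t} -> \sum_(x <- s) g x <= \sum_(x <- t) g x.
Proof.
elim: s t => [|x s IH] t; first by rewrite big_nil.
move=> /= /andP[xs us] st; rewrite big_cons.
have xt : x \in t by apply: st; rewrite mem_head.
rewrite (big_rem x xt) /= leq_add2l; apply: IH => // y ys.
have := st y; rewrite inE ys orbT => /(_ isT).
by rewrite (perm_mem (perm_to_rem xt)) inE => /orP[/eqP yx|//]; rewrite -yx ys in xs.
Qed.

(** Take [gcdn d a] as the first factor. The cofactor [d / gcdn d a] is coprime to [a / gcdn d a],
    so it divides [b]. *)
Lemma divisorsM_sub a b : 0 < a -> 0 < b ->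
  {subset divisors (a * b) <= [seq x * y | x <- divisors a, y <- divisors b]}.
Proof.
move=> a0 b0 d; rewrite -dvdn_divisors ?muln_gt0 ?a0 // => dab.
have d0 : 0 < d by apply: dvdn_gt0 dab; rewrite muln_gt0 a0.
have g0 : 0 < gcdn d a by rewrite gcdn_gt0 d0.
apply/allpairsP; exists (gcdn d a, d %/ gcdn d a) => /=; split.
- by rewrite -dvdn_divisors ?dvdn_gcdr.
- rewrite -dvdn_divisors //.
  have /Gauss_dvdr <- : coprime (d %/ gcdn d a) (a %/ gcdn d a).
    by rewrite /coprime -(eqn_pmul2r g0) muln_gcdl !divnK ?dvdn_gcdl ?dvdn_gcdr // mul1n.
  by rewrite -(dvdn_pmul2r g0) mulnAC !divnK ?dvdn_gcdl ?dvdn_gcdr.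
- by rewrite mulnC divnK ?dvdn_gcdl.
Qed.

(** Every divisor of [a * b] is a product of a divisor of [a] and one of [b], so the double sum over
    such pairs dominates, and induction on [k] bounds its terms. Coprimality is not assumed: the
    convolution bounds below apply this to arbitrary factorizations. *)
Lemma tau_mul_le k a b : 0 < a -> 0 < b -> tau k (a * b) <= tau k a * tau k b.
Proof.
elim: k a b => [//|k IH] a b a0 b0 /=.
apply: leq_trans (leq_sum_subset _ _ _ _ (divisors_uniq _) (divisorsM_sub a b a0 b0)) _.
rewrite big_allpairs_dep /= big_distrl /= big_seq [leqRHS]big_seq.
apply: leq_sum => x /(divisorsP _ _ a0)[x0 _]; rewrite big_distrr /= big_seq [leqRHS]big_seq.
by apply: leq_sum => y /(divisorsP _ _ b0)[y0 _]; apply: IH.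
Qed.

(** Submultiplicativity gives one inequality. For the other, coprimality makes [(x, y) -> x * y]
    injective on pairs of divisors, so no divisor of [a * b] is counted twice. *)
Lemma tau_mul_coprime k a b : 0 < a -> 0 < b -> coprime a b ->
  tau k (a * b) = tau k a * tau k b.
Proof.
elim: k a b => [//|k IH] a b a0 b0 cab.
apply/eqP; rewrite eqn_leq tau_mul_le //= big_distrl /=.
rewrite (eq_big_seq (fun x => \sum_(y <- divisors b) tau k (x * y))); last first.
  move=> x /(divisorsP _ _ a0)[x0 xa]; rewrite big_distrr /=; apply: eq_big_seq.
  move=> y /(divisorsP _ _ b0)[y0 yb]; rewrite IH //.
  exact: coprime_dvdl xa (coprime_dvdr yb cab).
rewrite -(big_allpairs_dep (h := muln) (r2 := fun=> divisors b) (F := tau k)).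
apply: leq_sum_subset.
  apply: allpairs_uniq; rewrite ?divisors_uniq //.
  move=> [x y] [x' y'] /allpairsP[[u v] /= [ua vb [-> ->]]].
  move=> /allpairsP[[u' v'] /= [ua' vb' [-> ->]]] /= E.
  have [u0 {}ua] := divisorsP _ _ a0 ua; have [_ {}ua'] := divisorsP _ _ a0 ua'.
  have [_ {}vb] := divisorsP _ _ b0 vb; have [_ {}vb'] := divisorsP _ _ b0 vb'.
  have uu : u = u'.
    apply/eqP; rewrite eqn_dvd; apply/andP; split.
      rewrite -(@Gauss_dvdl _ _ v'); last exact: coprime_dvdl ua (coprime_dvdr vb' cab).
      by rewrite -E dvdn_mulr.
    rewrite -(@Gauss_dvdl _ _ v); last exact: coprime_dvdl ua' (coprime_dvdr vb cab).
    by rewrite E dvdn_mulr.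
  by move: E; rewrite -uu => /eqP; rewrite eqn_pmul2l // => /eqP ->.
move=> d /allpairsP[[u v] /= [ua vb ->]].
have [u0 {}ua] := divisorsP _ _ a0 ua; have [v0 {}vb] := divisorsP _ _ b0 vb.
by rewrite -dvdn_divisors ?muln_gt0 ?a0 // dvdn_mul.
Qed.

Lemma leq_tau_dvd k a b : 0 < b -> a %| b -> tau k a <= tau k b.
Proof.
case: k => [//|k] b0 ab /=; have a0 := dvdn_gt0 b0 ab.
apply: leq_sum_subset (divisors_uniq _) _ => d.
by rewrite -!dvdn_divisors // => /dvdn_trans; apply.
Qed.

Lemma tau_prime k p : prime p -> tau k p = k.+1.
Proof.
move=> pp; elim: k => [//|k IH] /=.
have -> : \sum_(d <- divisors p) tau k d = \sum_(d <- [:: 1; p]) tau k d.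
  apply: perm_big; apply: uniq_perm (divisors_uniq _) _ _.
    by rewrite /= inE andbT neq_ltn prime_gt1.
  move=> d; rewrite -dvdn_divisors ?prime_gt0 // !inE.
  by apply/idP/idP=> [/(prime_nt_dvdP pp)|/orP[]/eqP->//]; case: eqP => //= _ ->.
rewrite !big_cons big_nil IH addn0.
suff -> : tau k 1 = 1 by [].
by elim: k {IH} => //= k IH; rewrite big_seq1.
Qed.

Lemma divisors_codivisors m : 0 < m ->
  perm_eq [seq m %/ d | d <- divisors m] (divisors m).
Proof.
move=> m0; have inv d : d \in divisors m -> m %/ (m %/ d) = d.
  move=> /(divisorsP _ _ m0)[d0 dm].
  by rewrite -{1}(divnK dm) mulKn // divn_gt0 // dvdn_leq.
apply: uniq_perm (divisors_uniq _) _.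
  rewrite map_inj_in_uniq ?divisors_uniq // => x y xm ym /= E.
  by rewrite -(inv x) // E inv.
move=> d; apply/mapP/idP => [[x xm ->]|dm].
  have [x0 {}xm] := divisorsP _ _ m0 xm.
  by rewrite -dvdn_divisors // -{2}(divnK xm) dvdn_mulr.
exists (m %/ d); last by rewrite inv.
have [d0 {}dm] := divisorsP _ _ m0 dm.
by rewrite -dvdn_divisors // -{2}(divnK dm) dvdn_mulr.
Qed.

Lemma tauS_codivisors k m : 0 < m -> \sum_(d <- divisors m) tau k (m %/ d) = tau k.+1 m.
Proof.
move=> m0; rewrite [RHS]/= -[RHS](perm_big _ (divisors_codivisors m m0)).
by rewrite [RHS]big_map.
Qed.

Lemma squarefreeP m : reflect (forall p, prime p -> logn p m <= 1) (squarefree m).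
Proof.
apply: (iffP allP) => [H p pp|H p].
  have [/H//|] := boolP (p \in primes m).
  by rewrite -logn_gt0 -eqn0Ngt => /eqP->.
by rewrite mem_primes => /andP[/H].
Qed.

Lemma squarefree_dvd a b : 0 < b -> a %| b -> squarefree b -> squarefree a.
Proof.
move=> b0 ab /squarefreeP sb; apply/squarefreeP => p /sb.
by apply: leq_trans; apply: dvdn_leq_log.
Qed.

Lemma squarefree_coprime a b : 0 < a -> 0 < b -> squarefree (a * b) -> coprime a b.
Proof.
move=> a0 b0 /squarefreeP sab; rewrite coprime_has_primes //.
apply/hasPn => p; rewrite !mem_primes => /and3P[pp _ pb]; rewrite pp a0 /=.
apply/negP => pa; have := sab p pp; rewrite lognM //.
move: (logn_gt0 p a) (logn_gt0 p b); rewrite !mem_primes pp a0 b0 pa pb /=; lia.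
Qed.

Lemma squarefree_prod_primes m : 0 < m -> squarefree m -> m = \prod_(p <- primes m) p.
Proof.
move=> m0 /allP sm; rewrite [LHS]prod_prime_decomp // prime_decompE big_map /=.
apply: eq_big_seq => p pm; have := sm _ pm; move: (pm); rewrite -logn_gt0.
by case: (logn p m) => [|[|]].
Qed.

(** Strong induction: as long as some [p ^ 2] divides [a], move [p] into [v]. *)
Lemma square_decomposition a : 0 < a ->
  exists u v, [/\ a = u * v ^ 2, 0 < u, 0 < v & squarefree u].
Proof.
elim/ltn_ind: a => a IH a0.
have [sa|/allPn[p]] := boolP (squarefree a).
  by exists a, 1; rewrite exp1n muln1.
rewrite -ltnNge mem_primes => /and3P[pp _ _] l2.
have /dvdnP[b ab] : p ^ 2 %| a by apply: dvdn_trans (pfactor_dvdnn p a); rewrite dvdn_exp2l.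
have p2 := prime_gt1 pp.
have b0 : 0 < b by move: a0; rewrite ab muln_gt0 => /andP[].
have ba : b < a by rewrite ab ltn_Pmulr // -(exp1n 2) ltn_exp2r.
have [u [v [E u0 v0 su]]] := IH b ba b0.
exists u, (v * p); split=> //; last by rewrite muln_gt0 v0 prime_gt0.
by rewrite ab E expnMn mulnA.
Qed.

(** * Products of primes and the size of the primorial *)

Lemma prod_primes_dvd (s : seq nat) (K : nat) :
  uniq s -> (forall p, p \in s -> prime p && (p %| K)) -> \prod_(p <- s) p %| K.
Proof.
elim: s K => [|p s IH] K /=; first by rewrite big_nil dvd1n.
move=> /andP[ps us] H; rewrite big_cons.
have /andP[pp pK] := H p (mem_head _ _).
rewrite Gauss_dvd ?pK ?IH //; first by move=> q qs; rewrite H // inE qs orbT.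
rewrite big_seq; apply: (big_ind (coprime p)) => [|x y cx cy|q qs]; first exact: coprimen1.
  by rewrite coprimeMr cx.
have /andP[qp _] := H q (mem_behead (s := p :: s) qs).
by rewrite prime_coprime // dvdn_prime2 //; apply: contraNneq ps => ->.
Qed.

Lemma primorial_gt0 n : 0 < primorial n.
Proof. by apply: prodn_cond_gt0 => p /prime_gt0. Qed.

Lemma primorial_mono m n : m <= n -> primorial m <= primorial n.
Proof.
move=> mn; rewrite /primorial (@big_cat_nat _ _ _ m.+1 1 n.+1) //=.
by rewrite leq_pmulr //; apply: prodn_cond_gt0 => p /prime_gt0.
Qed.

(** The two equal middle coefficients both occur in the expansion of [2 ^ (2 m + 1) = 2 * 4 ^ m]. *)
Lemma bin_half_le m : 'C(m.*2.+1, m) <= 4 ^ m.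
Proof.
have : \sum_(i < m.*2.+2) 'C(m.*2.+1, i) = 2 ^ m.*2.+1.
  by rewrite -[2]/(1 + 1) expnDn; apply: eq_bigr => i _; rewrite !exp1n !muln1.
have i1 : m < m.*2.+2 by lia.
have i2 : m.+1 < m.*2.+2 by lia.
rewrite (bigD1 (Ordinal i1)) //= (bigD1 (Ordinal i2)) /=; last by rewrite -val_eqE /= neq_ltn ltnS leqnn orbT.
have -> : 'C(m.*2.+1, m.+1) = 'C(m.*2.+1, m).
  by rewrite -bin_sub; [congr 'C(_, _); lia|lia].
have -> : 2 ^ m.*2.+1 = 2 * 4 ^ m by rewrite expnS -mul2n expnM.
lia.
Qed.

Lemma leq_prime_dvd_fact p k : prime p -> p %| k`! -> p <= k.
Proof.
move=> pp; elim: k => [|k IH]; first by rewrite dvdn1 => /eqP p1; rewrite p1 in pp.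
by rewrite factS Euclid_dvdM // => /orP[/dvdn_leq->//|/IH/leqW].
Qed.

(** Erdős's argument. For [n = 2 m + 1] the primes in [(m + 1, 2 m + 1]] divide
    ['C(2 m + 1, m) <= 4 ^ m], and the rest is [primorial (m + 1)]. An even number above 2 adds no
    prime. *)
Lemma primorial_le n : primorial n <= 4 ^ n.
Proof.
elim/ltn_ind: n => n IH.
case: n IH => [|[|[|n]]] IH; [by rewrite /primorial unlock|by rewrite /primorial unlock|by rewrite /primorial unlock|]; rewrite /primorial.
have [on|en] := boolP (odd n); last first.
  pose m := n.+2./2; have nE : n.+3 = m.*2.+1 by rewrite /m; lia.
  clearbody m.
  rewrite nE -/(primorial _) /primorial (@big_cat_nat _ _ _ m.+2 1) //=; last by lia.
  have -> : 4 ^ m.*2.+1 = 4 ^ m.+1 * 4 ^ m by rewrite -expnD; congr (_ ^ _); lia.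
  apply: leq_mul; first by apply: IH; lia.
  apply: leq_trans (bin_half_le m); apply: dvdn_leq; first by rewrite bin_gt0; lia.
  rewrite -big_filter; apply: prod_primes_dvd; first by rewrite filter_uniq ?iota_uniq.
  move=> p; rewrite mem_filter mem_index_iota => /and3P[pp p1 p2]; rewrite pp /=.
  have E : 'C(m.*2.+1, m) * (m`! * m.+1`!) = m.*2.+1`!.
    by rewrite -(@bin_fact m.*2.+1 m); [congr (_ * (_ * _`!)); lia|lia].
  have : p %| m.*2.+1`! by apply: dvdn_fact; rewrite prime_gt0 //; lia.
  rewrite -E Euclid_dvdM // (Euclid_dvdM m`! m.+1`!) // => /or3P[//||] /(leq_prime_dvd_fact _ _ pp); lia.
have -> : \prod_(1 <= p < n.+4 | prime p) p = primorial n.+2.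
  rewrite /primorial big_mkcond [RHS]big_mkcond [LHS]big_nat_recr // ifF; first by rewrite Monoid.mulm1.
  apply/negP => /even_prime[|]; [lia|by rewrite /= !negbK on].
by apply: leq_trans (IH _ _) _; rewrite ?leq_exp2l //.
Qed.

Lemma leq_prod_subset (T : eqType) (s t : seq T) (g : T -> nat) :
  uniq s -> {subset s <= t} -> (forall x, x \in t -> 0 < g x) ->
  \prod_(x <- s) g x <= \prod_(x <- t) g x.
Proof.
elim: s t => [|x s IH] t; first by rewrite big_nil => _ _ H; rewrite big_seq prodn_cond_gt0.
move=> /= /andP[xs us] st H; rewrite big_cons.
have xt : x \in t by apply: st; rewrite mem_head.
rewrite (big_rem x xt) /= leq_mul2l IH ?orbT // => y ys; last by apply: H; apply: mem_rem ys.
have := st y; rewrite inE ys orbT => /(_ isT).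
by rewrite (perm_mem (perm_to_rem xt)) inE => /orP[/eqP yx|//]; rewrite -yx ys in xs.
Qed.

(** By Legendre's formula the exponent of [p] is the sum over [k] of [floor (2 n / p ^ k) - 2 floor
    (n / p ^ k)]. Each summand is at most 1 and vanishes once [p ^ k > 2 n]. *)
Lemma logn_central_binomial p n : prime p -> 0 < n ->
  p ^ logn p 'C(n.*2, n) <= n.*2.
Proof.
move=> pp n0; have p1 := prime_gt1 pp.
have E : 'C(n.*2, n) * (n`! * n`!) = n.*2`!.
  by rewrite -(@bin_fact n.*2 n) -addnn ?addnK // leq_addr.
have C0 : 0 < 'C(n.*2, n) by rewrite bin_gt0; lia.
have /(congr1 (logn p)) := E.
rewrite !lognM ?muln_gt0 ?fact_gt0 // !logn_fact //.
have -> : \sum_(1 <= k < n.+1) n %/ p ^ k = \sum_(1 <= k < n.*2.+1) n %/ p ^ k.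
  rewrite [RHS](@big_cat_nat _ _ _ n.+1) //=; last by lia.
  rewrite [X in _ = _ + X]big_nat [X in _ = _ + X]big1 ?addn0 // => k /andP[nk _].
  by rewrite divn_small //; apply: ltn_trans (ltn_expl n p1) _; rewrite ltn_exp2l.
move=> L; set t := trunc_log p n.*2.
suff : logn p 'C(n.*2, n) <= t.
  by move=> h; apply: leq_trans (trunc_logP p1 _); [rewrite leq_exp2l|lia].
have -> : logn p 'C(n.*2, n) = \sum_(1 <= k < n.*2.+1) (n.*2 %/ p ^ k - (n %/ p ^ k).*2).
  rewrite sumnB => [|k _]; last first.
    by rewrite leq_divRL ?expn_gt0 ?prime_gt0 // -!muln2 mulnAC leq_mul2r leq_divM.
  under [X in _ = _ - X]eq_bigr => k _ do rewrite -addnn.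
  by rewrite -L big_split /= addnK.
have tn : t <= n.*2 by apply: leq_trans (ltnW (ltn_expl t p1)) _; apply: trunc_logP => //; lia.
rewrite (@big_cat_nat _ _ _ t.+1) //= [X in _ + X]big_nat [X in _ + X]big1 ?addn0 => [|k /andP[tk _]].
  apply: leq_trans (_ : \sum_(1 <= k < t.+1) 1 <= _); last by rewrite sum_nat_const_nat; lia.
  apply: leq_sum => k _; have pk0 : 0 < p ^ k by rewrite expn_gt0 ltnW.
  rewrite leq_subLR -ltnS ltn_divLR //.
  have := ltn_ceil n pk0; nia.
rewrite divn_small ?sub0n //; apply: leq_trans (trunc_log_ltn _ p1) _.
by rewrite leq_exp2l.
Qed.

(** In the factorization of ['C(2 n, n)] a prime above [s] has its square above [2 n], so it occurs
    at most once and is absorbed by the primorial. Each of the at most [s] smaller primes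
    contributes at most [2 n]. *)
Lemma central_binomial_le_primorial n s : 0 < n -> n.*2 < s.+1 ^ 2 ->
  2 ^ n <= primorial n.*2 * n.*2 ^ s.
Proof.
move=> n0 ns; apply: leq_trans (_ : 'C(n.*2, n) <= _).
  (* The sum of the ['C(n, i)] is compared term by term with the sum of their squares. *)
  rewrite -addnn -binomial.Vandermonde -[2]/(1 + 1) expnDn; apply: leq_sum => i _.
  rewrite !exp1n !muln1 bin_sub ?leq_pmulr ?bin_gt0 // -ltnS //.
have C0 : 0 < 'C(n.*2, n) by rewrite bin_gt0; lia.
rewrite [leqLHS]prod_prime_decomp // prime_decompE big_map /=.
apply: leq_trans (_ : \prod_(p <- primes 'C(n.*2, n)) (p * (if p <= s then n.*2 else 1)) <= _).
  rewrite big_seq [leqRHS]big_seq; apply: leq_prod => p.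
  rewrite mem_primes => /and3P[pp _ _]; have L := logn_central_binomial p n pp n0.
  case: (leqP p s) => ps; first by apply: leq_trans L _; rewrite leq_pmull // prime_gt0.
  rewrite muln1 -[leqRHS]expn1 leq_exp2l ?prime_gt1 // leqNgt; apply/negP => l2.
  have : p ^ 2 <= n.*2 by exact: leq_trans (leq_pexp2l (prime_gt0 pp) l2) L.
  by rewrite leqNgt (leq_trans ns) // leq_exp2r.
rewrite (leq_trans (leq_prod_subset _ _ [seq p <- index_iota 1 n.*2.+1 | prime p] _ (primes_uniq _) _ _)) //.
- move=> p; rewrite mem_filter mem_index_iota mem_primes => /and3P[pp _ pC].
  rewrite pp prime_gt0 //= ltnS; apply: leq_prime_dvd_fact pp _.
  by rewrite -(@bin_fact n.*2 n) ?dvdn_mulr // -addnn leq_addr.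
- move=> p; rewrite mem_filter => /andP[pp _]; rewrite muln_gt0 prime_gt0 //=.
  by case: ifP => // _; rewrite double_gt0.
rewrite big_filter big_split /= leq_mul2l; apply/orP; right.
rewrite -big_mkcondr /= -big_filter.
apply: leq_trans (leq_prod_subset _ _ (index_iota 1 s.+1) _ _ _ _) _.
- by rewrite filter_uniq ?iota_uniq.
- move=> p; rewrite mem_filter !mem_index_iota => /andP[/andP[_ ps] /andP[p0 _]].
  by rewrite p0 ltnS.
- by move=> *; rewrite double_gt0.
- by rewrite prod_nat_const_nat subSS subn0.
Qed.


(** * Four-fold products equal to a cube *)

Lemma logn_nonprime p m : ~~ prime p -> logn p m = 0.
Proof. by move=> /negbTE np; rewrite lognE np. Qed.

Lemma squarefree_four_factorization (w1 w2 w3 w4 : nat) :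
  0 < w1 -> 0 < w2 -> 0 < w3 -> 0 < w4 ->
  squarefree w1 -> squarefree w2 -> squarefree w3 -> squarefree w4 ->
  (forall p, prime p -> 3 %| logn p w1 + logn p w2 + logn p w3 + logn p w4) ->
  exists a b c d, [/\ w1 = b * c * d, w2 = a * c * d, w3 = a * b * d & w4 = a * b * c].
Proof.
move=> w10 w20 w30 w40 /squarefreeP s1 /squarefreeP s2 /squarefreeP s3 /squarefreeP s4 H.
(* The exponents are 0 or 1 and their sum is 0 or 3, so each prime that occurs is missed by exactly
   one [wi]. The first witness collects the primes missed by [w1], and so on. *)
exists (gcdn (gcdn w2 w3) w4), (gcdn (gcdn w1 w3) w4), (gcdn (gcdn w1 w2) w4), (gcdn (gcdn w1 w2) w3).
have E w x y z : 0 < w -> 0 < x -> 0 < y -> 0 < z ->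
    (forall p, prime p -> logn p w = logn p x + logn p y + logn p z) -> w = x * y * z.
  move=> w0 x0 y0 z0 h; apply: eqn_from_log => // [|p].
    by rewrite !muln_gt0 x0 y0 z0.
  have [pp|np] := boolP (prime p); last by rewrite !logn_nonprime.
  by rewrite !lognM ?muln_gt0 ?x0 ?y0 // h.
by split; apply: E; rewrite ?gcdn_gt0 ?w10 ?w20 ?w30 ?w40 // => p pp;
  rewrite !logn_gcd ?gcdn_gt0 ?w10 ?w20 ?w30 //;
  move: (s1 p pp) (s2 p pp) (s3 p pp) (s4 p pp) (H p pp); lia.
Qed.

(** Write [ai = ui * vi ^ 2] with [ui] squarefree and let [V] be the product of the [vi]. Dividing
    each [ui] by [gcdn ui V] removes all primes of [V]; at the other primes the exponents of the
    [ui] already add up to a multiple of 3. The quotients are thus triple products, and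
    [ri = gcdn ui V * vi ^ 2 <= M ^ 4 * M ^ 2]. *)
Lemma cube_four_factorization (a1 a2 a3 a4 x M : nat) :
  0 < a1 -> 0 < a2 -> 0 < a3 -> 0 < a4 ->
  (forall m, [|| m ^ 2 %| a1, m ^ 2 %| a2, m ^ 2 %| a3 | m ^ 2 %| a4] -> m <= M) ->
  a1 * a2 * a3 * a4 = x ^ 3 ->
  exists r1 r2 r3 r4 a b c d,
   [/\ a1 = r1 * (b * c * d), a2 = r2 * (a * c * d), a3 = r3 * (a * b * d) & a4 = r4 * (a * b * c)]
   /\ [/\ squarefree (b * c * d), r1 <= M ^ 6, r2 <= M ^ 6, r3 <= M ^ 6 & r4 <= M ^ 6].
Proof.
move=> a10 a20 a30 a40 sq E.
have [u1 [v1 [E1 u10 v10 s1]]] := square_decomposition a1 a10.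
have [u2 [v2 [E2 u20 v20 s2]]] := square_decomposition a2 a20.
have [u3 [v3 [E3 u30 v30 s3]]] := square_decomposition a3 a30.
have [u4 [v4 [E4 u40 v40 s4]]] := square_decomposition a4 a40.
pose V := v1 * v2 * v3 * v4.
have V0 : 0 < V by rewrite !muln_gt0 v10 v20 v30 v40.
have v1M : v1 <= M by apply: sq; rewrite E1 dvdn_mull.
have v2M : v2 <= M by apply: sq; rewrite E2 dvdn_mull ?orbT.
have v3M : v3 <= M by apply: sq; rewrite E3 dvdn_mull ?orbT.
have v4M : v4 <= M by apply: sq; rewrite E4 dvdn_mull ?orbT.
have VM : V <= M ^ 4 by rewrite /V !expnS expn0 muln1 !mulnA !leq_mul.
have VE : V = v1 * v2 * v3 * v4 by [].
clearbody V; pose w u := u %/ gcdn u V.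
have wE u : u = gcdn u V * w u by rewrite mulnC divnK ?dvdn_gcdl.
have g0 u : 0 < gcdn u V by rewrite gcdn_gt0 V0 orbT.
have w0 u : 0 < u -> 0 < w u by move=> u0; rewrite divn_gt0 // dvdn_leq ?dvdn_gcdl.
have sw u : 0 < u -> squarefree u -> squarefree (w u).
  by move=> u0; apply: squarefree_dvd => //; rewrite {2}(wE u) dvdn_mull.
have lw u p : 0 < u -> logn p (w u) = logn p u - minn (logn p u) (logn p V).
  by move=> u0; rewrite logn_div ?dvdn_gcdl // logn_gcd.
have H p : prime p -> 3 %| logn p (w u1) + logn p (w u2) + logn p (w u3) + logn p (w u4).
  move=> pp; rewrite !lw //.
  move: (squarefreeP _ s1 p pp) (squarefreeP _ s2 p pp) (squarefreeP _ s3 p pp) (squarefreeP _ s4 p pp).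
  have La u v : 0 < u -> 0 < v -> logn p (u * v ^ 2) = logn p u + 2 * logn p v.
    by move=> u0 v0; rewrite lognM ?expn_gt0 ?v0 // lognX.
  have := congr1 (logn p) E; rewrite lognX !lognM ?muln_gt0 ?a10 ?a20 ?a30 //.
  rewrite [in logn p a1]E1 [in logn p a2]E2 [in logn p a3]E3 [in logn p a4]E4 !La //.
  have -> : logn p V = logn p v1 + logn p v2 + logn p v3 + logn p v4.
    by rewrite VE !lognM ?muln_gt0 ?v10 ?v20 ?v30.
  lia.
have [a [b [c [d [W1 W2 W3 W4]]]]] := squarefree_four_factorization _ _ _ _
  (w0 _ u10) (w0 _ u20) (w0 _ u30) (w0 _ u40) (sw _ u10 s1) (sw _ u20 s2) (sw _ u30 s3) (sw _ u40 s4) H.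
have rM u v : v <= M -> gcdn u V * v ^ 2 <= M ^ 6.
  move=> vM; rewrite (expnD M 4 2) leq_mul ?leq_exp2r //.
  by apply: leq_trans VM; rewrite dvdn_leq ?dvdn_gcdr.
exists (gcdn u1 V * v1 ^ 2), (gcdn u2 V * v2 ^ 2), (gcdn u3 V * v3 ^ 2), (gcdn u4 V * v4 ^ 2), a, b, c, d.
split; last by split; rewrite ?rM // -W1 sw.
by split; rewrite -?W1 -?W2 -?W3 -?W4 mulnAC -wE.
Qed.

(** Here [w1], [w2], [w3] are the triple products containing [b] and [w] is the one without it. Then
    [b ^ 3 * w ^ 2 <= n ^ 3], while [w >= n / Q]. *)
Lemma window_upper (n Q b w w1 w2 w3 : nat) : 0 < n ->
  w1 * w2 * w3 = b ^ 3 * w ^ 2 -> w1 <= n -> w2 <= n -> w3 <= n -> n <= Q * w ->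
  b ^ 3 <= n * Q ^ 2.
Proof.
move=> n0 E h1 h2 h3 hw; rewrite -(@leq_pmul2r (n ^ 2)) ?expn_gt0 ?n0 //.
apply: leq_trans (_ : b ^ 3 * (Q * w) ^ 2 <= _); first by rewrite leq_mul2l leq_exp2r ?hw ?orbT.
have -> : b ^ 3 * (Q * w) ^ 2 = w1 * w2 * w3 * Q ^ 2 by rewrite E expnMn mulnA mulnAC.
have -> : n * Q ^ 2 * n ^ 2 = n * n * n * Q ^ 2 by rewrite mulnAC mulnn -expnSr.
by rewrite leq_mul2r !leq_mul ?orbT.
Qed.

(** Dividing [b * c * d >= n / Q] by the upper bounds for [c] and [d] gives
    [b ^ 3 >= (n / Q) ^ 3 / (n * Q ^ 2) ^ 2]. *)
Lemma window_lower (n Q b c d : nat) : 0 < n ->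
  c ^ 3 <= n * Q ^ 2 -> d ^ 3 <= n * Q ^ 2 -> n <= Q * (b * c * d) -> n <= b ^ 3 * Q ^ 7.
Proof.
move=> n0 hc hd h; rewrite -(@leq_pmul2r (n ^ 2)) ?expn_gt0 ?n0 // -expnS.
apply: leq_trans (_ : (Q * (b * c * d)) ^ 3 <= _); first by rewrite leq_exp2r.
have -> : (Q * (b * c * d)) ^ 3 = b ^ 3 * Q ^ 3 * (c ^ 3 * d ^ 3) by rewrite !expnMn; lia.
have -> : b ^ 3 * Q ^ 7 * n ^ 2 = b ^ 3 * Q ^ 3 * ((n * Q ^ 2) * (n * Q ^ 2)).
  by rewrite (_ : Q ^ 7 = Q ^ 3 * Q ^ 2 * Q ^ 2) -?expnD // -mulnn; lia.
by rewrite leq_mul2l leq_mul ?orbT.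
Qed.

Local Open Scope ring_scope.

(** * Sums of reciprocals of divisor functions *)

Lemma sum_divisors_swap (V : nmodType) (g : nat -> nat -> V) (N : nat) :
  \sum_(1 <= m < N.+1) \sum_(d <- divisors m) g d (m %/ d)%N =
  \sum_(1 <= d < N.+1) \sum_(1 <= e < (N %/ d).+1) g d e.
Proof.
transitivity (\sum_(1 <= m < N.+1) \sum_(1 <= d < N.+1 | (d %| m)%N) g d (m %/ d)%N).
  apply: eq_big_nat => m /andP[m0 mN]; rewrite -[RHS]big_filter; apply: perm_big.
  apply: uniq_perm; rewrite ?divisors_uniq ?filter_uniq ?iota_uniq // => d.
  rewrite mem_filter mem_index_iota -dvdn_divisors //.
  case dm: (d %| m)%N => //=; rewrite (dvdn_gt0 m0 dm) /=.
  by rewrite (leq_ltn_trans (dvdn_leq m0 dm)).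
rewrite (exchange_big_dep_nat xpredT) //=; apply: eq_big_nat => d /andP[d0 dN].
rewrite -big_filter.
have -> : \sum_(1 <= e < (N %/ d).+1) g d e =
   \sum_(m <- [seq (d * e)%N | e <- index_iota 1 (N %/ d).+1]) g d (m %/ d)%N.
  by rewrite big_map; apply: eq_bigr => e _; rewrite mulKn.
apply: perm_big; apply: uniq_perm; rewrite ?filter_uniq ?iota_uniq //.
  rewrite map_inj_uniq ?iota_uniq // => x y /eqP; rewrite eqn_pmul2l // => /eqP.
  exact.
move=> m; rewrite mem_filter mem_index_iota; apply/andP/mapP.
  move=> [/dvdnP[e ->] /andP[m0 mN]]; exists e; last by rewrite mulnC.
  rewrite mem_index_iota; rewrite muln_gt0 in m0; case/andP: m0 => -> _ /=.
  by rewrite ltnS leq_divRL.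
move=> [e]; rewrite mem_index_iota => /andP[e0 eN] ->; rewrite dvdn_mulr // muln_gt0 d0 e0 /=.
by split=> //; move: eN; rewrite !ltnS leq_divRL // mulnC.
Qed.

Lemma ln_prod_nat (R : realType) (s : seq nat) (P : pred nat) : all (ltn 0) [seq x <- s | P x] ->
  ln (\prod_(x <- s | P x) x)%:R = \sum_(x <- s | P x) ln x%:R :> R.
Proof.
rewrite -!(big_filter s P); move: [seq x <- s | P x] => {P}s.
elim: s => [|x s IH] /=; first by rewrite !big_nil ln1.
move=> /andP[x0 s0]; rewrite !big_cons natrM lnM ?posrE ?ltr0n // ?IH //.
by rewrite big_seq prodn_cond_gt0 // => y ys; apply: (allP s0).
Qed.

Lemma ln_primorial (R : realType) (n : nat) :
  ln (primorial n)%:R = \sum_(1 <= p < n.+1 | prime p) ln p%:R :> R.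
Proof.
apply: ln_prod_nat; apply/allP => p; rewrite mem_filter => /andP[pp _].
exact: prime_gt0.
Qed.

Lemma ln_primorial_le (R : realType) (n : nat) : ln (primorial n)%:R <= n%:R * ln 4 :> R.
Proof.
rewrite mulr_natl -lnXn // -natrX ler_ln ?posrE ?ltr0n ?expn_gt0 ?primorial_gt0 //.
by rewrite ler_nat primorial_le.
Qed.

(** Writing [m = e * p] turns the weight [\sum_(p | m) ln p] into a theta function at [N / e]. Both
    Chebyshev bounds enter through this identity. *)
Lemma sum_primes_swap (R : realType) (g : nat -> R) (N : nat) :
  \sum_(1 <= m < N.+1) g m * \sum_(p <- primes m) ln p%:R =
  \sum_(1 <= e < N.+1) \sum_(1 <= p < (N %/ e).+1 | prime p) g (e * p)%N * ln p%:R.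
Proof.
pose h d e : R := if prime e then g (d * e)%N * ln e%:R else 0.
transitivity (\sum_(1 <= m < N.+1) \sum_(d <- divisors m) h d (m %/ d)%N); last first.
  by rewrite sum_divisors_swap; apply: eq_bigr => e _; rewrite [RHS]big_mkcond.
apply: eq_big_nat => m /andP[m0 _].
transitivity (\sum_(d <- divisors m) if prime d then g m * ln d%:R else 0).
  rewrite -big_mkcond -big_filter mulr_sumr; apply: perm_big.
  apply: uniq_perm; rewrite ?primes_uniq ?filter_uniq ?divisors_uniq // => p.
  by rewrite mem_filter mem_primes m0 -dvdn_divisors.
rewrite -(perm_big _ (divisors_codivisors m m0)) big_map.
apply: eq_big_seq => d /(divisorsP _ _ m0)[d0 dm].
by rewrite /h mulnC divnK.
Qed.

Lemma ler_sum_range (R : numDomainType) (g : nat -> R) (m n : nat) :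
  (m <= n)%N -> (forall i, (0 < i)%N -> 0 <= g i) ->
  \sum_(1 <= i < m.+1) g i <= \sum_(1 <= i < n.+1) g i.
Proof.
move=> mn g0; rewrite [leRHS](@big_cat_nat _ _ _ m.+1) //= lerDl.
by rewrite big_nat; apply: sumr_ge0 => i /andP[mi _]; apply: g0; apply: leq_trans mi.
Qed.

(** Pairs in the box [[1, x] * [1, y]] have product at most [x * y]. The next lemma is the converse
    inclusion: pairs with product at most [x] lie in the box of side [x]. *)
Lemma ler_sum_pairs_divisors (R : numDomainType) (g : nat -> nat -> R) (x y : nat) :
  (forall d e, (0 < d)%N -> (0 < e)%N -> 0 <= g d e) ->
  \sum_(1 <= d < x.+1) \sum_(1 <= e < y.+1) g d e <=
  \sum_(1 <= m < (x * y).+1) \sum_(d <- divisors m) g d (m %/ d)%N.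
Proof.
move=> g0; rewrite sum_divisors_swap.
have [->|y0] := posnP y.
  rewrite muln0 [leRHS]big_geq // big1 // => i _; by rewrite big_geq.
apply: (@le_trans _ _ (\sum_(1 <= d < x.+1) \sum_(1 <= e < ((x * y) %/ d).+1) g d e)).
  rewrite big_nat [leRHS]big_nat; apply: ler_sum => d /andP[d0 dx].
  apply: ler_sum_range => [|e e0]; last exact: g0.
  by rewrite leq_divRL // mulnC leq_mul2r -ltnS dx orbT.
apply: ler_sum_range => [|d d0]; first by rewrite leq_pmulr.
by rewrite big_nat; apply: sumr_ge0 => e /andP[e0 _]; apply: g0.
Qed.

Lemma ler_sum_divisors_pairs (R : numDomainType) (g : nat -> nat -> R) (x : nat) :
  (forall d e, (0 < d)%N -> (0 < e)%N -> 0 <= g d e) ->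
  \sum_(1 <= m < x.+1) \sum_(d <- divisors m) g d (m %/ d)%N <=
  \sum_(1 <= d < x.+1) \sum_(1 <= e < x.+1) g d e.
Proof.
move=> g0; rewrite sum_divisors_swap big_nat [leRHS]big_nat.
apply: ler_sum => d /andP[d0 _]; apply: ler_sum_range => [|e]; last exact: g0.
exact: leq_div.
Qed.

(** * Harmonic sums and convolutions of reciprocal divisor functions *)

Lemma harmonic_le (R : realType) (n : nat) : (0 < n)%N ->
  \sum_(1 <= m < n.+1) m%:R^-1 <= 1 + ln n%:R :> R.
Proof.
elim: n => // -[|n] IH _; first by rewrite big_nat1 ln1 addr0 invr1.
rewrite big_nat_recr //=; apply: le_trans (lerD (IH isT) (lexx _)) _.
rewrite -addrA lerD2l -lerBrDl.
have n1 : (0 : R) < n.+1%:R by rewrite ltr0n.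
have n2 : (0 : R) < n.+2%:R by rewrite ltr0n.
rewrite -lerN2 opprB -ln_div ?posrE //.
have -> : n.+1%:R / n.+2%:R = 1 + - n.+2%:R^-1 :> R.
  apply: (mulIf (lt0r_neq0 n2)); rewrite divfK ?gt_eqF // mulrBl mul1r mulVf ?gt_eqF //.
  by rewrite -[n.+2%:R]natr1 addrK.
by apply: le_ln1Dx; rewrite ltrN2 invf_lt1 // ltr1n.
Qed.

Lemma harmonic_ge (R : realType) (n : nat) :
  ln n.+1%:R <= \sum_(1 <= m < n.+1) m%:R^-1 :> R.
Proof.
elim: n => [|n IH]; first by rewrite big_geq // ln1.
rewrite big_nat_recr //=; apply: le_trans (lerD IH (lexx _)).
have n1 : (0 : R) < n.+1%:R by rewrite ltr0n.
have n2 : (0 : R) < n.+2%:R by rewrite ltr0n.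
rewrite -lerBlDl -ln_div ?posrE //.
have -> : n.+2%:R / n.+1%:R = 1 + n.+1%:R^-1 :> R.
  by rewrite -natr1 mulrDl divff ?gt_eqF // mul1r.
by apply: le_ln1Dx; apply: lt_trans (ltrN10 _) _; rewrite invr_gt0.
Qed.

(** The index is one less than the number of factors: [itau R 1] is [1 / tau_2] and [itau R 2] is
    [1 / tau_3] in the usual notation. *)
Definition itau (R : realType) (k m : nat) : R := (tau k m)%:R^-1.

Lemma itau_ge0 (R : realType) k m : 0 <= itau R k m.
Proof. by rewrite invr_ge0. Qed.

Lemma itau_le1 (R : realType) k m : (0 < m)%N -> itau R k m <= 1.
Proof. by move=> m0; rewrite invf_le1 ?ltr0n ?ler1n tau_gt0. Qed.

Lemma itauM_le (R : realType) k a b : (0 < a)%N -> (0 < b)%N ->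
  itau R k a * itau R k b <= itau R k (a * b).
Proof.
move=> a0 b0; rewrite -invfM -natrM lef_pV2 ?posrE ?ltr0n ?muln_gt0 ?tau_gt0 ?muln_gt0 ?a0 //.
by rewrite ler_nat tau_mul_le.
Qed.

Lemma itauM_coprime (R : realType) k a b : (0 < a)%N -> (0 < b)%N -> coprime a b ->
  itau R k (a * b) = itau R k a * itau R k b.
Proof. by move=> a0 b0 ab; rewrite /itau tau_mul_coprime // natrM invfM. Qed.

Lemma itau_dvd_le (R : realType) k a b : (0 < b)%N -> (a %| b)%N -> itau R k b <= itau R k a.
Proof.
move=> b0 ab; have a0 := dvdn_gt0 b0 ab.
by rewrite lef_pV2 ?posrE ?ltr0n ?tau_gt0 // ler_nat leq_tau_dvd.
Qed.

Lemma divisors_div m d : (0 < m)%N -> d \in divisors m ->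
  [/\ (0 < d)%N, (0 < m %/ d)%N & (d * (m %/ d) = m)%N].
Proof.
move=> m0 /(divisorsP _ _ m0)[d0 dm]; split=> //; last by rewrite mulnC divnK.
by rewrite divn_gt0 // dvdn_leq.
Qed.

(** By submultiplicativity each of the [tau 1 m] terms is at most [1 / tau 1 m]. *)
Lemma conv_itau1_le (R : realType) m : (0 < m)%N ->
  \sum_(d <- divisors m) itau R 1 d * itau R 1 (m %/ d) <= 1.
Proof.
move=> m0; apply: le_trans (_ : \sum_(d <- divisors m) itau R 1 m <= _).
  rewrite big_seq [leRHS]big_seq; apply: ler_sum => d /(divisors_div _ _ m0)[d0 e0 E].
  by rewrite -[in leRHS]E; apply: itauM_le.
rewrite big_const_seq count_predT iter_addr_0 -mulr_natl -tau1E divff //.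
by rewrite pnatr_eq0 -lt0n tau_gt0.
Qed.

(** The pairs [(b, c)] enumerate the [tau 2 m] ordered factorizations of [m] into three factors. *)
Lemma conv_itau2_const (R : realType) m : (0 < m)%N ->
  \sum_(b <- divisors m) \sum_(c <- divisors (m %/ b)) itau R 2 m = 1.
Proof.
move=> m0; under eq_bigr => b _ do
  rewrite big_const_seq count_predT iter_addr_0 -mulr_natl -tau1E.
rewrite -mulr_suml -natr_sum tauS_codivisors // divff //.
by rewrite pnatr_eq0 -lt0n tau_gt0.
Qed.

Lemma conv_itau2_le (R : realType) m : (0 < m)%N ->
  \sum_(b <- divisors m) \sum_(c <- divisors (m %/ b))
     itau R 2 b * itau R 2 c * itau R 2 (m %/ b %/ c) <= 1.
Proof.
move=> m0; rewrite -[leRHS](conv_itau2_const R m) //.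
rewrite big_seq [leRHS]big_seq; apply: ler_sum => b /(divisors_div _ _ m0)[b0 mb0 E].
rewrite big_seq [leRHS]big_seq; apply: ler_sum => c /(divisors_div _ _ mb0)[c0 d0 E'].
rewrite -mulrA -[in leRHS]E -[in leRHS]E'.
apply: le_trans (itauM_le R 2 _ _ b0 _); last by rewrite muln_gt0 c0.
by apply: ler_wpM2l; rewrite ?itau_ge0 // itauM_le.
Qed.

Lemma conv_itau2_squarefree (R : realType) m : (0 < m)%N -> squarefree m ->
  \sum_(b <- divisors m) \sum_(c <- divisors (m %/ b))
     itau R 2 b * itau R 2 c * itau R 2 (m %/ b %/ c) = 1.
Proof.
move=> m0 sm; rewrite -[RHS](conv_itau2_const R m) //.
apply: eq_big_seq => b /(divisors_div _ _ m0)[b0 mb0 E].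
apply: eq_big_seq => c /(divisors_div _ _ mb0)[c0 d0 E'].
have s1 : squarefree (b * (m %/ b)) by rewrite E.
have s2 : squarefree (c * (m %/ b %/ c)).
  by rewrite E'; apply: squarefree_dvd m0 _ sm; apply/dvdnP; exists b.
rewrite -mulrA -[in RHS]E itauM_coprime ?squarefree_coprime //.
by congr (_ * _); rewrite -[in RHS]E' itauM_coprime ?squarefree_coprime.
Qed.

(** In the square, the pairs with product [m] carry weight at most [1 / m], and [m] runs up to
    [x ^ 2]; this leaves a harmonic sum. *)
Lemma log_sum_itau1_sqr_le (R : realType) x : (0 < x)%N ->
  (\sum_(1 <= m < x.+1) itau R 1 m / m%:R) ^+ 2 <= 1 + 2 * ln x%:R.
Proof.
move=> x0; rewrite expr2 mulr_suml.
under eq_bigr => d _ do rewrite mulr_sumr.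
apply: le_trans (ler_sum_pairs_divisors R _ _ _ _) _ => [d e _ _|].
  by rewrite !mulr_ge0 ?itau_ge0 ?invr_ge0.
apply: (@le_trans _ _ (1 + ln (x * x)%:R)); last first.
  by rewrite natrM lnM ?posrE ?ltr0n // mulr_natl.
apply: le_trans (harmonic_le R _ _); last by rewrite muln_gt0 x0.
rewrite big_nat [leRHS]big_nat; apply: ler_sum => m /andP[m0 _].
apply: (@le_trans _ _ ((\sum_(d <- divisors m) itau R 1 d * itau R 1 (m %/ d)) / m%:R)).
  rewrite mulr_suml le_eqVlt; apply/orP; left; apply/eqP.
  apply: eq_big_seq => d /(divisors_div _ _ m0)[d0 e0 E].
  have -> : m%:R = d%:R * (m %/ d)%:R :> R by rewrite -natrM E.
  by rewrite invfM mulrACA.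
by rewrite -[leRHS]mul1r ler_wpM2r ?invr_ge0 ?conv_itau1_le.
Qed.

(** Expand the cube and keep only the triples with product at most [x]. A squarefree product [m]
    then receives total weight exactly [1 / m]. *)
Lemma log_sum_itau2_cube_ge (R : realType) x :
  \sum_(1 <= m < x.+1 | squarefree m) m%:R^-1 <=
  (\sum_(1 <= m < x.+1) itau R 2 m / m%:R) ^+ 3.
Proof.
set g := fun m => itau R 2 m / m%:R.
have g0 m : 0 <= g m by rewrite mulr_ge0 ?itau_ge0 ?invr_ge0.
have -> : (\sum_(1 <= m < x.+1) g m) ^+ 3 =
  \sum_(1 <= b < x.+1) g b * \sum_(1 <= c < x.+1) \sum_(1 <= d < x.+1) g c * g d.
  rewrite exprS expr2 mulr_suml; apply: eq_bigr => b _; congr (_ * _).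
  by rewrite mulr_suml; apply: eq_bigr => c _; rewrite mulr_sumr.
apply: (@le_trans _ _ (\sum_(1 <= b < x.+1) \sum_(1 <= k < x.+1)
    g b * \sum_(c <- divisors k) g c * g (k %/ c)%N)); last first.
  rewrite big_nat [leRHS]big_nat; apply: ler_sum => b _; rewrite -mulr_sumr.
  apply: ler_wpM2l => //; apply: ler_sum_divisors_pairs => *; exact: mulr_ge0.
apply: le_trans (ler_sum_divisors_pairs R _ x _); last first.
  by move=> b k _ _; apply: mulr_ge0 => //; apply: sumr_ge0 => *; apply: mulr_ge0.
rewrite big_mkcond big_nat [leRHS]big_nat; apply: ler_sum => m /andP[m0 _].
case: ifP => sm; last first.
  by apply: sumr_ge0 => *; apply: mulr_ge0 => //; apply: sumr_ge0 => *; apply: mulr_ge0.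
rewrite -[leLHS]mul1r -[X in X * _ <= _](conv_itau2_squarefree R m) // mulr_suml le_eqVlt.
apply/orP; left; apply/eqP; apply: eq_big_seq => b /(divisors_div _ _ m0)[b0 mb0 E].
rewrite mulr_suml mulr_sumr; apply: eq_big_seq => c /(divisors_div _ _ mb0)[c0 d0 E'].
have -> : m%:R = b%:R * (c%:R * (m %/ b %/ c)%:R) :> R by rewrite -!natrM E' E.
by rewrite /g !invfM; ring.
Qed.

Lemma sum_inv_squares_le (R : realType) (m n : nat) : (0 < m)%N ->
  \sum_(m.+1 <= k < n) (k%:R ^+ 2)^-1 <= m%:R^-1 :> R.
Proof.
move=> m0; have [nm|mn] := leqP n m.+1; first by rewrite big_geq // invr_ge0.
apply: (@le_trans _ _ (\sum_(m.+1 <= k < n) (k.-1%:R^-1 - k%:R^-1))).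
  rewrite big_nat [leRHS]big_nat; apply: ler_sum => -[//|k] /andP[mk _] /=.
  have k0 : (0 : R) < k%:R by rewrite ltr0n; lia.
  have k1 : (0 : R) < k.+1%:R by rewrite ltr0n.
  have -> : k%:R^-1 - k.+1%:R^-1 = (k%:R * k.+1%:R)^-1 :> R.
    by rewrite -natr1; field; rewrite natr1 !gt_eqF.
  rewrite lef_pV2 ?posrE ?exprn_gt0 ?mulr_gt0 // expr2 ler_pM2r // ler_nat //.
have -> : \sum_(m.+1 <= k < n) (k.-1%:R^-1 - k%:R^-1) = m%:R^-1 - n.-1%:R^-1 :> R.
  case: n mn => // n mn; rewrite big_add1 /= -[LHS]opprK -sumrN.
  under eq_bigr => i _ do rewrite opprB.
  by rewrite (telescope_sumr (fun i => i%:R^-1 : R)) ?opprB // ltnW.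
by rewrite gerBl invr_ge0.
Qed.

(** Since every [m] has the form [s * k ^ 2] with [s] squarefree, the harmonic sum is at most the
    squarefree one times [\sum 1 / k ^ 2 <= 2]. *)
Lemma squarefree_harmonic_ge (R : realType) (n : nat) :
  ln n.+1%:R / 2 <= \sum_(1 <= m < n.+1 | squarefree m) m%:R^-1 :> R.
Proof.
rewrite ler_pdivrMr //; apply: le_trans (harmonic_ge R n) _.
set Q := (X in _ <= X * 2).
have Q0 : 0 <= Q by apply: sumr_ge0 => *; rewrite invr_ge0.
have K2 : \sum_(1 <= k < n.+1) (k%:R ^+ 2)^-1 <= 2 :> R.
  case: n {Q Q0} => [|n]; first by rewrite big_geq.
  rewrite big_ltn // expr1n invr1 -[leRHS]/(1 + 1) lerD2l.
  by rewrite (le_trans (sum_inv_squares_le R 1 _ _)) ?invr1.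
apply: le_trans (ler_wpM2l Q0 K2).
rewrite /Q mulr_suml.
under [leRHS]eq_bigr => s _ do rewrite mulr_sumr.
apply: (@le_trans _ _ (\sum_(1 <= m < n.+1) \sum_(1 <= s < n.+1 | squarefree s)
   \sum_(1 <= k < n.+1) if (m == s * k ^ 2)%N then s%:R^-1 * (k%:R ^+ 2)^-1 else 0 : R)).
  rewrite big_nat [leRHS]big_nat; apply: ler_sum => m /andP[m0 mn].
  have [s [k [E s0 k0 ss]]] := square_decomposition m m0.
  have T0 s' k' : 0 <= (if (m == s' * k' ^ 2)%N then s'%:R^-1 * (k'%:R ^+ 2)^-1 else 0 : R).
    by case: ifP => // _; rewrite mulr_ge0 ?invr_ge0 ?exprn_ge0.
  have si : s \in index_iota 1 n.+1.
    by rewrite mem_index_iota s0 (leq_ltn_trans _ mn) // E leq_pmulr ?expn_gt0 ?k0.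
  have ki : k \in index_iota 1 n.+1.
    rewrite mem_index_iota k0 (leq_ltn_trans _ mn) // E.
    by rewrite (leq_trans (leq_pmulr k k0)) // mulnn leq_pmull.
  rewrite (big_rem s si) ss (big_rem k ki) /= -E eqxx -addrA.
  have -> : m%:R^-1 = s%:R^-1 * (k%:R ^+ 2)^-1 :> R by rewrite E natrM natrX invfM.
  rewrite lerDl addr_ge0 //; apply: sumr_ge0 => i _; first exact: T0.
  by apply: sumr_ge0 => j _; apply: T0.
rewrite exchange_big /=; apply: ler_sum => s _.
rewrite exchange_big /=; apply: ler_sum => k _.
rewrite -big_mkcond /= -big_filter.
have [/eqP->|] := boolP ([seq m <- index_iota 1 n.+1 | m == s * k ^ 2]%N == [::]).
  by rewrite big_nil mulr_ge0 ?invr_ge0 ?exprn_ge0.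
rewrite -has_filter => /hasP[m mi /eqP E].
by rewrite -E (filter_pred1_uniq (iota_uniq _ _) mi) big_seq1.
Qed.

(** * Chebyshev's lower bound and mean values of reciprocal divisor functions *)

Lemma nat_root_floor (k x : nat) : (0 < k)%N -> exists s, (s ^ k <= x < s.+1 ^ k)%N.
Proof.
move=> k0; elim: x => [|x [s /andP[sx xs]]]; first by exists 0%N; rewrite exp0n // exp1n.
have [xs1|sx1] := ltnP x.+1 (s.+1 ^ k); first by exists s; rewrite xs1 (leq_trans sx).
exists s.+1; rewrite sx1 (leq_trans _ (_ : s.+1 ^ k < s.+2 ^ k)%N) ?ltn_exp2r //.
Qed.

Lemma ln_nat_ge0 (R : realType) (n : nat) : 0 <= ln n%:R :> R.
Proof. by case: n => [|n]; [rewrite ln0 | rewrite ln_ge0 // ler1n]. Qed.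

Lemma ler_ln_nat (R : realType) (m n : nat) : (m <= n)%N -> ln m%:R <= ln n%:R :> R.
Proof.
case: m => [|m] mn; first by rewrite ln0 // ln_nat_ge0.
by rewrite ler_ln ?posrE ?ltr0n ?ler_nat //; apply: leq_trans mn.
Qed.

Lemma ln2_le1 (R : realType) : ln 2 <= 1 :> R.
Proof. by have := @le_ln1Dx R 1; apply; apply: lt_trans (ltrN10 _) _. Qed.

Lemma ln2_ge_half (R : realType) : 1 / 2 <= ln 2 :> R.
Proof.
have := @le_ln1Dx R (- (1 / 2)); rewrite (_ : 1 + - (1 / 2) = 2^-1); last by lra.
by rewrite lnV ?posrE // lerN2; apply; lra.
Qed.

Lemma theta_ge (R : realType) : exists N0 : nat, forall N : nat, (N0 <= N)%N ->
  N%:R / 12 <= ln (primorial N)%:R :> R.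
Proof.
exists (1026 ^ 2).+1 => N hN; pose n := N./2.
have [s /andP[s1 s2]] := nat_root_floor 2 n.*2 isT.
have N3 : (N <= n.*2.+1)%N by rewrite /n; lia.
(* The value 1025 is the least [s] with [1024 * (s + 1) <= s ^ 2], which is [L2] squared. It makes
   the loss [s * ln (2 n)] at most [n / 4], against a main term of at least [n / 2]. *)
have hs : (1025 <= s)%N.
  by rewrite -ltnS -(@ltn_exp2r _ _ 2) //; apply: leq_ltn_trans s2; lia.
have n0 : (0 < n)%N by rewrite -double_gt0 (leq_trans _ s1) // expn_gt0; lia.
have := central_binomial_le_primorial n s n0 s2.
rewrite -(ler_nat R) natrM !natrX => C.
have : n%:R * ln 2 <= ln (primorial n.*2)%:R + s%:R * ln n.*2%:R :> R.
  rewrite !mulr_natl -!lnXn ?ltr0n ?double_gt0 // -lnM ?posrE ?exprn_gt0 ?ltr0n ?double_gt0 ?primorial_gt0 //.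
  by rewrite ler_ln // posrE ?exprn_gt0 // mulr_gt0 ?exprn_gt0 ?ltr0n ?double_gt0 ?primorial_gt0.
have L1 : ln n.*2%:R <= 4 * Num.sqrt s.+1%:R :> R.
  apply: le_trans (_ : ln (s.+1 ^ 2)%N%:R <= _); first by rewrite ler_ln_nat // ltnW.
  have s10 : (0 : R) < Num.sqrt s.+1%:R by rewrite sqrtr_gt0 ltr0n.
  rewrite natrX -{1}(@sqr_sqrtr _ s.+1%:R) // -exprM lnXn //.
  by rewrite mulr_natl ler_pMn2r // ltW // ln_sublinear.
have L2 : 32 * Num.sqrt s.+1%:R <= s%:R :> R.
  rewrite -(@ler_pXn2r _ 2) ?nnegrE ?mulr_ge0 ?sqrtr_ge0 // exprMn sqr_sqrtr //.
  by rewrite -!natrX -natrM ler_nat; nia.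
have L3 : s%:R * s%:R <= 2 * n%:R :> R by rewrite -!natrM ler_nat; lia.
have L4 : ln (primorial n.*2)%:R <= ln (primorial N)%:R :> R.
  by apply/ler_ln_nat/primorial_mono; rewrite /n; lia.
have L5 : s%:R * ln n.*2%:R <= n%:R / 4 :> R.
  have s0 : (0 : R) <= s%:R by [].
  have := ler_wpM2l s0 L1; have := ler_wpM2l s0 L2; lra.
have L6 : n%:R * (1 / 2) <= n%:R * ln 2 :> R by rewrite ler_wpM2l // ln2_ge_half.
have L7 : N%:R <= 3 * n%:R :> R by rewrite -natrM ler_nat; lia.
lra.
Qed.

Lemma squarefree_sum_itau1_le (R : realType) (N : nat) : 1 <= ln N%:R :> R ->
  \sum_(1 <= m < N.+1 | squarefree m) itau R 1 m <= 6 * N%:R / Num.sqrt (ln N%:R).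
Proof.
move=> lN; set H := \sum_(_ <= _ < _ | _) _; set L := ln _ in lN *.
have N0 : (0 < N)%N by case: N @H @L lN => // H L; rewrite /L ln0 // ler10.
have L0 : 0 < L by apply: lt_le_trans lN.
set S := \sum_(1 <= m < N.+1) itau R 1 m / m%:R.
have S0 : 0 <= S by apply: sumr_ge0 => *; rewrite mulr_ge0 ?invr_ge0 ?itau_ge0.
(* ln N = ln m + ln (N / m), where ln m is the sum of the ln p over p | m and
   ln (N / m) <= N / m. *)
have key : H * L <= 3 * N%:R * S.
  apply: (@le_trans _ _ (\sum_(1 <= m < N.+1) itau R 1 m *
    \sum_(p <- primes m) ln p%:R + N%:R * S)).
    rewrite /S mulr_sumr -big_split /= /H mulr_suml big_mkcond.
    rewrite big_nat [leRHS]big_nat; apply: ler_sum => m /andP[m0 mN].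
    have mR : (0 : R) < m%:R by rewrite ltr0n.
    have NR : (0 : R) < N%:R by rewrite ltr0n.
    rewrite [N%:R * _]mulrCA -mulrDr; case: ifP => sm; last first.
      rewrite mulr_ge0 ?itau_ge0 // addr_ge0 ?mulr_ge0 ?invr_ge0 //.
      by apply: sumr_ge0 => *; apply: ln_nat_ge0.
    apply: ler_wpM2l; first exact: itau_ge0.
    rewrite -ln_prod_nat; last first.
      by apply/allP => p; rewrite filter_predT mem_primes => /andP[/prime_gt0].
    rewrite -squarefree_prod_primes // -lerBlDl -ln_div ?posrE //.
    by rewrite ltW // ln_sublinear // divr_gt0.
  rewrite sum_primes_swap.
  suff : \sum_(1 <= e < N.+1) \sum_(1 <= p < (N %/ e).+1 | prime p)
      itau R 1 (e * p) * ln p%:R <= 2 * (N%:R * S) by lra.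
  rewrite /S 2!mulr_sumr big_nat [leRHS]big_nat; apply: ler_sum => e /andP[e0 eN].
  (* Dropping [p] from [e * p] only increases [itau], after which the primes sum to
     [ln (primorial (N / e)) <= (N / e) * ln 4]. *)
  apply: (@le_trans _ _ (itau R 1 e * ln (primorial (N %/ e))%:R)).
    rewrite ln_primorial mulr_sumr; apply: ler_sum => p pp.
    rewrite ler_wpM2r ?ln_nat_ge0 // itau_dvd_le ?muln_gt0 ?e0 ?prime_gt0 //.
    exact: dvdn_mulr.
  have -> : 2 * (N%:R * (itau R 1 e / e%:R)) = itau R 1 e * (N%:R / e%:R * 2) by ring.
  apply: ler_wpM2l; first exact: itau_ge0.
  apply: le_trans (ln_primorial_le _ _) _.
  apply: ler_pM; rewrite ?ln_nat_ge0 //.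
    by rewrite ler_pdivlMr ?ltr0n // -natrM ler_nat leq_divM.
  rewrite (_ : 4 = 2 ^+ 2 :> R) ?lnXn //; last by rewrite -natrX.
  by rewrite mulr2n; have := ln2_le1 R; lra.
have SS : S <= 2 * Num.sqrt L.
  rewrite -(@ler_pXn2r _ 2) ?nnegrE ?mulr_ge0 ?sqrtr_ge0 // exprMn sqr_sqrtr ?(ltW L0) //.
  by apply: le_trans (log_sum_itau1_sqr_le R N N0) _; rewrite -/L; lra.
have q0 : 0 < Num.sqrt L by rewrite sqrtr_gt0.
rewrite ler_pdivlMr // -(ler_pM2r q0) -mulrA -expr2 sqr_sqrtr ?(ltW L0) //.
apply: le_trans key _.
have := ler_wpM2l (_ : 0 <= 3 * N%:R) SS; rewrite mulr_ge0 // => /(_ isT); lra.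
Qed.

Lemma sum_itau2_cube_ge (R : realType) : exists c : R, 0 < c /\
  exists X0 : nat, forall X : nat, (X0 <= X)%N ->
  c * X%:R ^+ 3 <= (\sum_(1 <= m < X.+1) itau R 2 m) ^+ 3 * ln X%:R ^+ 2.
Proof.
have [N0 th] := theta_ge R.
pose N1 := N0.+2.
(* Here [72 = 3 * 12 * 2]: the 3 is [tau 2 p], the 12 comes from [theta_ge], and the 2 from
   replacing [X / e] by its floor. The 4 comes from [S3]. *)
exists ((1 / 72) ^+ 3 / 4); split; first by rewrite divr_gt0 ?exprn_gt0 ?divr_gt0.
exists (N1 ^ 2)%N => X hX; set M := \sum_(_ <= _ < _) _.
have N11 : (1 < N1)%N by [].
have X1 : (1 < X)%N by apply: leq_trans hX; rewrite (leq_trans N11) // -{1}(expn1 N1) leq_exp2l.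
set L := ln _; have L0 : 0 < L by rewrite ln_gt0 // ltr1n.
(* Only cofactors [e <= Y] are kept, so that [X / e] is large enough for Chebyshev's lower bound. *)
pose Y := (X %/ N1)%N.
set S := \sum_(1 <= m < Y.+1) itau R 2 m / m%:R.
have S0 : 0 <= S by apply: sumr_ge0 => *; rewrite mulr_ge0 ?invr_ge0 ?itau_ge0.
have key : X%:R / 72 * S <= M * L.
  apply: (@le_trans _ _ (\sum_(1 <= m < X.+1) itau R 2 m * \sum_(p <- primes m) ln p%:R)); last first.
    rewrite /M mulr_suml big_nat [leRHS]big_nat; apply: ler_sum => m /andP[m0 mX].
    apply: ler_wpM2l; first exact: itau_ge0.
    rewrite -ln_prod_nat; last first.
      by apply/allP => p; rewrite filter_predT mem_primes => /andP[/prime_gt0].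
    apply: ler_ln_nat; apply: leq_trans (_ : m <= X)%N => //.
    apply: dvdn_leq => //; apply: prod_primes_dvd; first exact: primes_uniq.
    by move=> p; rewrite mem_primes => /and3P[-> _ ->].
  rewrite sum_primes_swap.
  have YX : (Y <= X)%N by exact: leq_div.
  rewrite [leRHS](@big_cat_nat _ _ _ Y.+1) //= -[leLHS]addr0.
  apply: lerD; last first.
    by do 2 apply: sumr_ge0 => ? _; rewrite mulr_ge0 ?itau_ge0 ?ln_nat_ge0.
  rewrite /S mulr_sumr [leLHS]big_nat [leRHS]big_nat; apply: ler_sum => e /andP[e0 eY].
  apply: (@le_trans _ _ (itau R 2 e / 3 * ln (primorial (X %/ e))%:R)); last first.
    rewrite ln_primorial mulr_sumr; apply: ler_sum => p pp.
    rewrite ler_wpM2r ?ln_nat_ge0 //; apply: le_trans (itauM_le R 2 _ _ e0 (prime_gt0 pp)).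
    by rewrite /itau (tau_prime 2 p pp).
  have -> : X%:R / 72 * (itau R 2 e / e%:R) = itau R 2 e / 3 * (X%:R / e%:R / 24) by field; rewrite pnatr_eq0 -lt0n.
  apply: ler_wpM2l; first by rewrite divr_ge0 ?itau_ge0.
  have NX : (N1 <= X %/ e)%N.
    rewrite leq_divRL // mulnC -leq_divRL //.
  apply: le_trans (th _ _); last by apply: leq_trans NX; rewrite /N1; lia.
  have : X%:R / e%:R <= 2 * (X %/ e)%:R :> R.
    rewrite ler_pdivrMr ?ltr0n // -!natrM ler_nat.
    have := ltn_ceil X e0; nia.
  lra.
have S3 : L / 4 <= S ^+ 3.
  apply: le_trans (log_sum_itau2_cube_ge R Y); apply: le_trans (squarefree_harmonic_ge R Y).
  (* As [X >= N1 ^ 2], cutting at [Y] costs at most a factor 2 in the logarithm. *)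
  have : ln X%:R <= ln (Y.+1 ^ 2)%N%:R :> R.
    apply: ler_ln_nat; rewrite -mulnn; apply: leq_trans (_ : N1 * Y.+1 <= _)%N.
      by have := ltn_ceil X (ltnW N11); rewrite -/Y mulnC => /ltnW.
    rewrite leq_mul2r; apply/orP; right; apply: leqW.
    by rewrite leq_divRL // mulnn.
  by rewrite natrX lnXn ?ltr0n // -/L; lra.
have P3 : (X%:R / 72 * S) ^+ 3 <= (M * L) ^+ 3.
  have M0 : 0 <= M by apply: sumr_ge0 => *; apply: itau_ge0.
  by rewrite ler_pXn2r // nnegrE mulr_ge0 // ?divr_ge0 // ltW.
have X30 : 0 <= (X%:R / 72) ^+ 3 :> R by rewrite exprn_ge0 ?divr_ge0.
rewrite -(ler_pM2r L0) -[leRHS]mulrA -exprSr -exprMn; apply: le_trans P3.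
rewrite [leRHS]exprMn; apply: le_trans (ler_wpM2l X30 S3).
by rewrite !exprMn; lra.
Qed.

(** * Every cube-free set misses many integers *)

(** Sorting [s] gives the increasing tuple and leaves the product unchanged. *)
Lemma no_increasing_solution_seq (k d n : nat) (A : {set 'I_n.+1}) (s : seq nat) (y : nat) :
  no_increasing_solution k d A -> size s = k -> uniq s ->
  all (fun x => (x <= n)%N && (inord x \in A)) s -> (\prod_(x <- s) x = y ^ d)%N -> False.
Proof.
move=> hA sk us sA sy; pose t := sort leq s.
have tk : size t = k by rewrite size_sort.
have st : sorted ltn t by rewrite ltn_sorted_uniq_leq sort_uniq us sort_sorted //; apply: leq_total.
have nt (i : 'I_k) : (nth 0%N t i <= n)%N && (inord (nth 0%N t i) \in A).
  by apply: (allP sA); rewrite -(mem_sort leq) mem_nth // tk.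
have inK (i : 'I_k) : (inord (nth 0%N t i) : 'I_n.+1) = nth 0%N t i :> nat.
  by rewrite inordK //; case/andP: (nt i).
apply: (hA (fun i => inord (nth 0%N t i))) => [i|i j ij|].
- by case/andP: (nt i).
- by rewrite !inK; apply: (sorted_ltn_nth ltn_trans) => //; rewrite inE tk.
- exists (Posz y); rewrite -!natz -natrX -sy -(perm_big _ (permEl (perm_sort leq s))) /=.
  rewrite (big_nth 0%N) big_mkord -/t tk; congr _%:R.
  by apply: eq_bigr => i _; rewrite inK.
Qed.

Lemma sum_complement (R : numDomainType) (n : nat) (A : {set 'I_n.+1}) : ord0 \notin A ->
  \sum_(1 <= a < n.+1) (inord a \notin A)%:R = n%:R - #|A|%:R :> R.
Proof.
move=> A0; have -> : #|A|%:R = \sum_(1 <= a < n.+1) (inord a \in A)%:R :> R.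
  rewrite -sum1_card big_mkcond /= -natr_sum; congr _%:R.
  rewrite big_add1 /= big_mkord big_ord_recl (negbTE A0) add0n.
  by apply: eq_bigr => i _; rewrite -[lift _ _]inord_val; case: ifP.
have -> : n%:R = \sum_(1 <= a < n.+1) 1 :> R by rewrite big_const_nat iter_addr_0 subn1.
by rewrite -sumrB; apply: eq_bigr => a _; case: (_ \in A); rewrite ?subrr ?subr0.
Qed.

(** Integration over [[1, X]] against the measure giving [m] the mass [1 / tau_3(m)]; [wsum4]
    integrates against its fourfold product, so that quadruples are counted with product weights. *)
Definition wsum (R : realType) (X : nat) (h : nat -> R) : R :=
  \sum_(1 <= m < X.+1) itau R 2 m * h m.

Definition wsum4 (R : realType) (X : nat) (h : nat -> nat -> nat -> nat -> R) : R :=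
  wsum R X (fun b => wsum R X (fun c => wsum R X (fun d => wsum R X (h b c d)))).

Lemma ler_wsum (R : realType) X (h h' : nat -> R) :
  (forall m, (0 < m <= X)%N -> h m <= h' m) -> wsum R X h <= wsum R X h'.
Proof.
move=> hh; rewrite /wsum big_nat [leRHS]big_nat; apply: ler_sum => m mX.
by apply: ler_wpM2l; [exact: itau_ge0|exact: hh].
Qed.

Lemma wsum_ge0 (R : realType) X (h : nat -> R) : (forall m, 0 <= h m) -> 0 <= wsum R X h.
Proof. by move=> h0; apply: sumr_ge0 => m _; rewrite mulr_ge0 ?itau_ge0. Qed.

Lemma wsumD (R : realType) X (h h' : nat -> R) :
  wsum R X (fun m => h m + h' m) = wsum R X h + wsum R X h'.
Proof. by rewrite /wsum -big_split /=; apply: eq_bigr => m _; rewrite mulrDr. Qed.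

Lemma wsumZ (R : realType) X k (h : nat -> R) :
  wsum R X (fun m => k * h m) = k * wsum R X h.
Proof. by rewrite /wsum mulr_sumr; apply: eq_bigr => m _; rewrite mulrCA. Qed.

Lemma wsum_cst (R : realType) X (k : R) : wsum R X (fun=> k) = wsum R X (fun=> 1) * k.
Proof. by rewrite mulrC -wsumZ mulr1. Qed.

Lemma eq_wsum (R : realType) X (h h' : nat -> R) : h =1 h' -> wsum R X h = wsum R X h'.
Proof. by move=> hh; apply: eq_bigr => m _; rewrite hh. Qed.

Lemma wsum_eq_le1 (R : realType) X b : wsum R X (fun c => (b == c)%:R) <= 1.
Proof.
rewrite /wsum; have [bX|bX] := boolP (b \in index_iota 1 X.+1); last first.
  rewrite big_seq big1 ?ler01 // => c cX; case: eqP => [E|_]; last by rewrite mulr0.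
  by rewrite E cX in bX.
rewrite (bigD1_seq b) ?iota_uniq //= eqxx mulr1 big1 ?addr0; last first.
  by move=> c; rewrite eq_sym => /negbTE->; rewrite mulr0.
by apply: itau_le1; move: bX; rewrite mem_index_iota => /andP[].
Qed.

Lemma wsum4D (R : realType) X (h h' : nat -> nat -> nat -> nat -> R) :
  wsum4 R X (fun b c d e => h b c d e + h' b c d e) = wsum4 R X h + wsum4 R X h'.
Proof.
rewrite /wsum4 -wsumD; apply: eq_wsum => b; rewrite -wsumD; apply: eq_wsum => c.
by rewrite -wsumD; apply: eq_wsum => d; rewrite -wsumD.
Qed.

Lemma ler_wsum4 (R : realType) X (h h' : nat -> nat -> nat -> nat -> R) :
  (forall b c d e, (0 < b <= X)%N -> (0 < c <= X)%N -> (0 < d <= X)%N -> (0 < e <= X)%N ->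
    h b c d e <= h' b c d e) -> wsum4 R X h <= wsum4 R X h'.
Proof.
by move=> hh; do 4 (apply: ler_wsum => ? ?); apply: hh.
Qed.

(** By [conv_itau2_le], the triples with a given product [m] have total mass at most 1, and all
    products are at most [X ^ 3 <= n]. *)
Lemma wsum3_le (R : realType) (X n : nat) (u : nat -> R) : (X ^ 3 <= n)%N ->
  (forall m, 0 <= u m) ->
  wsum R X (fun b => wsum R X (fun c => wsum R X (fun d => u (b * c * d)%N))) <=
  \sum_(1 <= m < n.+1) u m.
Proof.
move=> Xn u0.
pose f3 b c d := itau R 2 b * itau R 2 c * itau R 2 d * u (b * c * d)%N.
have f30 b c d : 0 <= f3 b c d by rewrite !mulr_ge0 ?itau_ge0.
have -> : wsum R X (fun b => wsum R X (fun c => wsum R X (fun d => u (b * c * d)%N))) =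
   \sum_(1 <= b < X.+1) \sum_(1 <= c < X.+1) \sum_(1 <= d < X.+1) f3 b c d.
  rewrite /wsum; apply: eq_bigr => b _; rewrite mulr_sumr; apply: eq_bigr => c _.
  by rewrite mulrA mulr_sumr; apply: eq_bigr => d _; rewrite /f3; ring.
apply: (@le_trans _ _ (\sum_(1 <= b < X.+1) \sum_(1 <= k < (X * X).+1)
   \sum_(c <- divisors k) f3 b c (k %/ c)%N)).
  by apply: ler_sum => b _; apply: ler_sum_pairs_divisors => *; apply: f30.
apply: le_trans (ler_sum_pairs_divisors R _ _ _ _) _.
  by move=> b k _ _; apply: sumr_ge0 => *; apply: f30.
apply: le_trans (ler_sum_range R _ (X * (X * X)) n _ _); last 2 first.
- by rewrite mulnn -expnS.
- by move=> *; apply: u0.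
rewrite big_nat [leRHS]big_nat; apply: ler_sum => m /andP[m0 _].
rewrite -[leRHS]mul1r; apply: le_trans (ler_wpM2r (u0 m) (conv_itau2_le R m m0)).
rewrite mulr_suml le_eqVlt; apply/orP; left; apply/eqP.
apply: eq_big_seq => b /(divisors_div _ _ m0)[b0 mb0 E].
rewrite mulr_suml; apply: eq_big_seq => c /(divisors_div _ _ mb0)[c0 d0 E'].
by rewrite /f3 -mulnA E' E.
Qed.

Lemma uniq_triple_products (b c d e : nat) :
  (0 < b -> 0 < c -> 0 < d -> 0 < e ->
   b != c -> b != d -> b != e -> c != d -> c != e -> d != e ->
   uniq [:: c * d * e; b * d * e; b * c * e; b * c * d])%N.
Proof.
move=> b0 c0 d0 e0 bc bd be cd ce de; rewrite /= !inE !negb_or !andbT.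
have ne x y w m m' : (0 < w -> x != y -> m = x * w -> m' = y * w -> m != m')%N.
  by move=> w0 xy -> ->; rewrite eqn_pmul2r.
have n1 : (c * d * e != b * d * e)%N.
  by apply: (ne c b (d * e)%N); [rewrite muln_gt0 d0|rewrite 1?eq_sym|clear; lia|clear; lia].
have n2 : (c * d * e != b * c * e)%N.
  by apply: (ne d b (c * e)%N); [rewrite muln_gt0 c0|rewrite 1?eq_sym|clear; lia|clear; lia].
have n3 : (c * d * e != b * c * d)%N.
  by apply: (ne e b (c * d)%N); [rewrite muln_gt0 c0|rewrite 1?eq_sym|clear; lia|clear; lia].
have n4 : (b * d * e != b * c * e)%N.
  by apply: (ne d c (b * e)%N); [rewrite muln_gt0 b0|rewrite 1?eq_sym|clear; lia|clear; lia].
have n5 : (b * d * e != b * c * d)%N.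
  by apply: (ne e c (b * d)%N); [rewrite muln_gt0 b0|rewrite 1?eq_sym|clear; lia|clear; lia].
have n6 : (b * c * e != b * c * d)%N.
  by apply: (ne e d (b * c)%N); [rewrite muln_gt0 b0|rewrite 1?eq_sym|clear; lia|clear; lia].
by rewrite n1 n2 n3 n4 n5 n6.
Qed.

Lemma prod_triple_products (b c d e : nat) :
  (\prod_(x <- [:: c * d * e; b * d * e; b * c * e; b * c * d]) x = (b * c * d * e) ^ 3)%N.
Proof. by rewrite !big_cons big_nil !expnS expn0; lia. Qed.

(** With [M] the total mass and [E] the number of integers outside [A], covering the quadruples
    gives [M ^ 4 <= 6 M ^ 3 + 4 M E]: six diagonals and four triple products. The hypothesis
    [M >= 12] absorbs the diagonals into half of the left side. *)
Lemma complement_ge_wsum (R : realType) (n X : nat) (A : {set 'I_n.+1}) :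
  no_increasing_solution 4 3 A -> ord0 \notin A -> (X ^ 3 <= n)%N ->
  12 <= wsum R X (fun=> 1) ->
  wsum R X (fun=> 1) ^+ 3 <= 8 * (n%:R - #|A|%:R).
Proof.
move=> hA A0 Xn M12; rewrite -sum_complement //.
pose u m : R := (inord m \notin A)%:R; set E := \sum_(_ <= _ < _) _.
have u0 m : 0 <= u m by rewrite /u.
set M := wsum _ _ _ in M12 *.
have M0 : 0 < M by lra.
(* A quadruple of distinct integers yields a solution unless one of its four
   triple products lies outside [A]. *)
have cover : wsum4 R X (fun _ _ _ _ => 1) <= wsum4 R X (fun b c d e =>
    (b == c)%:R + (b == d)%:R + (b == e)%:R + (c == d)%:R + (c == e)%:R + (d == e)%:R +
    u (c * d * e)%N + u (b * d * e)%N + u (b * c * e)%N + u (b * c * d)%N).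
  apply: ler_wsum4 => b c d e /andP[b0 bX] /andP[c0 cX] /andP[d0 dX] /andP[e0 eX].
  case: (eqVneq b c) => bc; first by rewrite -!addrA lerDl !addr_ge0.
  case: (eqVneq b d) => bd; first by rewrite -!addrA add0r lerDl !addr_ge0.
  case: (eqVneq b e) => be; first by rewrite -!addrA !add0r lerDl !addr_ge0.
  case: (eqVneq c d) => cd; first by rewrite -!addrA !add0r lerDl !addr_ge0.
  case: (eqVneq c e) => ce; first by rewrite -!addrA !add0r lerDl !addr_ge0.
  case: (eqVneq d e) => de; first by rewrite -!addrA !add0r lerDl !addr_ge0.
  rewrite !add0r leNgt; apply/negP => lt1.
  have uu m m' : u m + u m' < 1 -> inord m \in A /\ inord m' \in A.
    by rewrite /u -natrD ltrn1; case: (inord m \in A); case: (inord m' \in A).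
  have [Ha Hb] : inord (c * d * e)%N \in A /\ inord (b * d * e)%N \in A.
    by apply: uu; apply: le_lt_trans lt1; rewrite -addrA lerDl addr_ge0.
  have [Hc Hd] : inord (b * c * e)%N \in A /\ inord (b * c * d)%N \in A.
    by apply: uu; apply: le_lt_trans lt1; rewrite -addrA lerDr addr_ge0.
  have le3 x y z : (x <= X -> y <= X -> z <= X -> x * y * z <= n)%N.
    by move=> hx hy hz; apply: leq_trans Xn; rewrite !expnS muln1 mulnA !leq_mul.
  apply: (no_increasing_solution_seq 4 3 n A
    [:: c * d * e; b * d * e; b * c * e; b * c * d]%N (b * c * d * e)%N hA (erefl _)).
  - exact: uniq_triple_products.
  - by rewrite /= Ha Hb Hc Hd !le3.
  - exact: prod_triple_products.
have wM k : wsum R X (fun=> k) = M * k by apply: wsum_cst.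
have T1 : wsum4 R X (fun _ _ _ _ => 1) = M ^+ 4 by rewrite /wsum4 !wM; ring.
rewrite T1 !wsum4D in cover.
have B1 : wsum4 R X (fun b c d e => (b == c)%:R) <= M ^+ 3.
  rewrite /wsum4; apply: le_trans (_ : wsum R X (fun=> M * (M * 1)) <= _); last by rewrite wM; lra.
  apply: ler_wsum => b _; under eq_wsum do rewrite !wM.
  by rewrite !wsumZ !ler_wpM2l ?wsum_eq_le1 // ltW.
have B2 : wsum4 R X (fun b c d e => (b == d)%:R) <= M ^+ 3.
  rewrite /wsum4; apply: le_trans (_ : wsum R X (fun=> wsum R X (fun=> M * 1)) <= _); last by rewrite !wM; lra.
  apply: ler_wsum => b _; apply: ler_wsum => c _; under eq_wsum do rewrite !wM.
  by rewrite !wsumZ !ler_wpM2l ?wsum_eq_le1 // ltW.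
have B4 : wsum4 R X (fun b c d e => (c == d)%:R) <= M ^+ 3.
  rewrite /wsum4; apply: le_trans (_ : wsum R X (fun=> wsum R X (fun=> M * 1)) <= _); last by rewrite !wM; lra.
  apply: ler_wsum => b _; apply: ler_wsum => c _; under eq_wsum do rewrite !wM.
  by rewrite !wsumZ !ler_wpM2l ?wsum_eq_le1 // ltW.
have B3 (h : nat -> nat -> nat -> nat) : wsum4 R X (fun b c d e => (h b c d == e)%:R) <= M ^+ 3.
  rewrite /wsum4; apply: le_trans (_ : wsum R X (fun=> wsum R X (fun=> wsum R X (fun=> 1))) <= _); last by rewrite !wM; lra.
  by do 3 (apply: ler_wsum => ? _); apply: wsum_eq_le1.
have E3 := wsum3_le R X n u Xn u0; rewrite -/E in E3.
have C1 : wsum4 R X (fun b c d e => u (c * d * e)%N) <= M * E.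
  by rewrite /wsum4 wM ler_wpM2l // ltW.
have C2 : wsum4 R X (fun b c d e => u (b * d * e)%N) <= M * E.
  rewrite /wsum4; under eq_wsum do rewrite wM.
  by rewrite wsumZ ler_wpM2l // ltW.
have C3 : wsum4 R X (fun b c d e => u (b * c * e)%N) <= M * E.
  rewrite /wsum4; under eq_wsum => b do under eq_wsum do rewrite wM.
  by under eq_wsum do rewrite wsumZ; rewrite wsumZ ler_wpM2l // ltW.
have C4 : wsum4 R X (fun b c d e => u (b * c * d)%N) <= M * E.
  rewrite /wsum4; under eq_wsum => b do under eq_wsum => c do (under eq_wsum do rewrite wM; rewrite wsumZ).
  by under eq_wsum do rewrite wsumZ; rewrite wsumZ ler_wpM2l // ltW.
have {}cover : M ^+ 4 <= 6 * M ^+ 3 + 4 * (M * E).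
  have B3a := B3 (fun b _ _ => b); have B3b := B3 (fun _ c _ => c); have B3c := B3 (fun _ _ d => d).
  lra.
rewrite -(ler_pM2l M0); have M3 : 0 < M ^+ 3 by rewrite exprn_gt0.
have : 12 * M ^+ 3 <= M ^+ 4 by rewrite exprS ler_pM2r.
rewrite -exprS; lra.
Qed.

Lemma natr_eventually_gt (R : realType) (K : R) :
  exists n0 : nat, forall n : nat, (n0 <= n)%N -> K < n%:R.
Proof.
exists (Num.Def.archi_bound `|K|) => n hn; apply: le_lt_trans (ler_norm K) _.
by apply: lt_le_trans (archi_boundP (normr_ge0 K)) _; rewrite ler_nat.
Qed.

Lemma ln_eventually_gt (R : realType) (K : R) :
  exists n0 : nat, forall n : nat, (n0 <= n)%N -> K < ln n%:R.
Proof.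
have [n0 h] := natr_eventually_gt R (expR K); exists n0 => n /h hn.
by rewrite -[K]expRK ltr_ln ?posrE ?expR_gt0 // (lt_trans _ hn) ?expR_gt0.
Qed.

Lemma complement_lower_bound (R : realType) (eps : R) : 0 < eps ->
  exists n0 : nat, forall n : nat, (n0 <= n)%N -> forall A : {set 'I_n.+1},
    no_increasing_solution 4 3 A -> ord0 \notin A ->
    n%:R / ln n%:R `^ (2 + eps) < n%:R - #|A|%:R :> R.
Proof.
move=> e0; have [c [c0 [X0 HX]]] := sum_itau2_cube_ge R.
(* Since [1728 = 12 ^ 3], this threshold on [X] yields the mass of at least 12 that
   [complement_ge_wsum] requires. *)
have [n1 h1] := natr_eventually_gt R (1728 / c).
have [n2 h2] := ln_eventually_gt R ((64 / c) `^ eps^-1).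
have [n3 h3] := ln_eventually_gt R 1.
exists ((maxn X0 (maxn n1 2)) ^ 3 + n2 + n3)%N => n hn A hA A0.
have [X /andP[Xn nX]] := nat_root_floor 3 n isT.
have : (maxn X0 (maxn n1 2) < X.+1)%N.
  by rewrite -(@ltn_exp2r _ _ 3) //; apply: leq_ltn_trans nX; apply: leq_trans hn; rewrite -[X in (_ <= X)%N]addnA; exact: leq_addr.
rewrite ltnS !geq_max => /and3P[XX0 Xn1 X2].
have {}h2 := h2 n (leq_trans (leq_trans (leq_addl _ _) (leq_addr _ _)) hn).
have {}h3 := h3 n (leq_trans (leq_addl _ _) hn).
have {h1} cX : 1728 < c * X%:R by have := h1 X Xn1; rewrite ltr_pdivrMr // mulrC.
set L := ln n%:R in h2 h3 *; have L0 : 0 < L by apply: lt_trans h3.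
have n0 : (0 : R) < n%:R by rewrite ltr0n (leq_trans _ Xn) // expn_gt0 (ltnW X2).
have XR : (1 : R) < X%:R by rewrite ltr1n.
have X0R : (0 : R) < X%:R by apply: lt_trans XR.
have := HX X XX0; set S := wsum R X (fun=> 1).
have -> : \sum_(1 <= m < X.+1) itau R 2 m = S by apply: eq_bigr => m _; rewrite mulr1.
move=> {}HX; set lX := ln X%:R in HX.
have lX0 : 0 < lX by rewrite ln_gt0.
have lXL : lX <= L.
  by apply: ler_ln_nat; apply: leq_trans Xn; rewrite -{1}(expn1 X) leq_exp2l.
have S0 : 0 <= S by apply: wsum_ge0.
have S12 : 12 <= S.
  rewrite -(@ler_pXn2r _ 3) ?nnegrE // -(ler_pM2r (exprn_gt0 2 lX0)).
  apply: le_trans HX; apply: (@le_trans _ _ (12 ^+ 3 * X%:R ^+ 2)).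
    by rewrite ler_pM2l ?exprn_gt0 // ler_pXn2r ?nnegrE ?ltW // ln_sublinear.
  rewrite [X%:R ^+ 3]exprS mulrA ler_pM2r ?exprn_gt0 //; apply: ltW; apply: le_lt_trans cX.
  by rewrite -natrX ler_nat.
have := complement_ge_wsum R n X A hA A0 Xn S12; rewrite -/S => hS.
set E := n%:R - _ in hS *.
have X8 : n%:R <= 8 * X%:R ^+ 3 :> R.
  rewrite -natrX -natrM ler_nat; apply: leq_trans (ltnW nX) _.
  by rewrite -[8%N]/(2 ^ 3)%N -expnMn leq_exp2r // mul2n -addnn -addn1 leq_add2l ltnW.
have key : c / 64 * n%:R <= E * L ^+ 2.
  apply: (@le_trans _ _ (c / 8 * X%:R ^+ 3)).
    by have := ler_wpM2l (ltW c0) X8; lra.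
  have := ler_wpM2r (exprn_ge0 2 (ltW L0)) hS.
  have : S ^+ 3 * lX ^+ 2 <= S ^+ 3 * L ^+ 2.
    by rewrite ler_wpM2l ?exprn_ge0 // ler_pXn2r ?nnegrE ?(ltW lX0) ?(ltW L0).
  lra.
(* The extra power [eps] serves only to absorb the constant of [key]. *)
have Le : 64 / c < L `^ eps.
  have c64 : 0 <= 64 / c by rewrite divr_ge0 // ltW.
  have -> : 64 / c = ((64 / c) `^ eps^-1) `^ eps.
    by rewrite -powRrM mulVf ?gt_eqF // powRr1.
  by apply: gt0_ltr_powR; rewrite ?nnegrE ?powR_ge0 ?(ltW L0).
have -> : L `^ (2 + eps) = L ^+ 2 * L `^ eps.
  by rewrite powRD ?(gt_eqF L0) ?implybT // powR_mulrn // ltW.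
have L20 : 0 < L ^+ 2 by rewrite exprn_gt0.
have Lp0 : 0 < L `^ eps by rewrite powR_gt0.
rewrite ltr_pdivrMr ?mulr_gt0 //.
have EL0 : 0 < E * L ^+ 2 by apply: lt_le_trans key; rewrite mulr_gt0 // divr_gt0.
rewrite mulrA; apply: (@le_lt_trans _ _ (E * L ^+ 2 * (64 / c))); last by rewrite ltr_pM2l.
by rewrite mulrA ler_pdivlMr //; lra.
Qed.

(** * A large set without solutions *)

Lemma ler_term_sum (R : numDomainType) (T : eqType) (s : seq T) (P : pred T) (g : T -> R) x :
  x \in s -> P x -> (forall y, P y -> 0 <= g y) -> g x <= \sum_(y <- s | P y) g y.
Proof.
by move=> xs Px g0; rewrite (big_rem x xs) Px lerDl sumr_ge0.
Qed.

Lemma ler_sum_subset (R : numDomainType) (T : eqType) (s t : seq T) (g : T -> R) :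
  uniq s -> {subset s <= t} -> (forall x, 0 <= g x) -> \sum_(x <- s) g x <= \sum_(x <- t) g x.
Proof.
move=> + + g0; elim: s t => [|x s IH] t; first by rewrite big_nil sumr_ge0.
move=> /= /andP[xs us] st; rewrite big_cons.
have xt : x \in t by apply: st; rewrite mem_head.
rewrite (big_rem x xt) /= lerD2l; apply: IH => // y ys.
have := st y; rewrite inE ys orbT => /(_ isT).
by rewrite (perm_mem (perm_to_rem xt)) inE => /orP[/eqP yx|//]; rewrite -yx ys in xs.
Qed.

Lemma sum_dvdn_le (R : realType) (n k : nat) : (0 < k)%N ->
  \sum_(1 <= a < n.+1) (k %| a)%N%:R <= n%:R / k%:R :> R.
Proof.
move=> k0; apply: (@le_trans _ _ (n %/ k)%N%:R); last first.
  by rewrite ler_pdivlMr ?ltr0n // -natrM ler_nat leq_divM.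
have -> : \sum_(1 <= a < n.+1) (k %| a)%N%:R =
    \sum_(1 <= a < n.+1) \sum_(d <- divisors a) (d == k)%:R :> R.
  apply: eq_big_nat => a /andP[a0 _]; rewrite dvdn_divisors //.
  have [ka|ka] := boolP (k \in divisors a).
    rewrite (bigD1_seq k) ?divisors_uniq //= eqxx big1 ?addr0 // => d.
    by move=> /negbTE->.
  rewrite big_seq big1 // => d da; case: eqP => // dk.
  by rewrite -dk da in ka.
rewrite (sum_divisors_swap _ (fun d _ => (d == k)%:R)).
have [kn|nk] := boolP (k \in index_iota 1 n.+1).
  rewrite (bigD1_seq k) ?iota_uniq //= eqxx [X in _ + X]big1 ?addr0.
    by rewrite big_const_nat iter_addr_0 subn1.
  by move=> d /negbTE->; rewrite big1.
rewrite big_seq big1 // => d da; case: eqP => [dk|_]; last by rewrite big1.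
by rewrite -dk da in nk.
Qed.

Lemma sum_tau1_le (R : realType) (n : nat) :
  \sum_(1 <= a < n.+1) (tau 1 a)%:R <= n%:R * (1 + ln n%:R) :> R.
Proof.
have [->|n0] := posnP n; first by rewrite big_geq ?mul0r.
under eq_bigr => a _ do rewrite /= natr_sum.
rewrite (sum_divisors_swap _ (fun _ _ => 1%:R)).
apply: le_trans (ler_wpM2l _ (harmonic_le R n n0)) => //.
rewrite mulr_sumr big_nat [leRHS]big_nat; apply: ler_sum => d /andP[d0 _].
rewrite big_const_nat iter_addr_0 subn1 /=.
by rewrite ler_pdivlMr ?ltr0n // -natrM ler_nat leq_divM.
Qed.

(** Induction over the [J] dyadic blocks. On a block [(Y, 2 Y]] one has [1 / m <= 1 / Y], so the
    block costs at most [6 * (2 Y) / Y] divided by the square root of the logarithm. *)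
Lemma window_log_sum_le (R : realType) (Z J : nat) : 1 <= ln Z%:R :> R ->
  \sum_(Z.+1 <= m < (Z * 2 ^ J).+1 | squarefree m) itau R 1 m / m%:R <=
  J%:R * (12 / Num.sqrt (ln Z%:R)).
Proof.
move=> lZ; have Z0 : (0 < Z)%N by case: Z lZ => // lZ; rewrite ln0 // ler10 in lZ.
have q0 : 0 < Num.sqrt (ln Z%:R) :> R by rewrite sqrtr_gt0 (lt_le_trans _ lZ).
elim: J => [|J IH]; first by rewrite big_geq ?mul0r // muln1.
have J0 : (0 < 2 ^ J)%N by rewrite expn_gt0.
have JJ : (Z * 2 ^ J <= Z * 2 ^ J.+1)%N by rewrite leq_mul2l leq_exp2l // leqnSn orbT.
rewrite (@big_cat_nat _ _ _ (Z * 2 ^ J).+1) //=; last by rewrite ltnS leq_pmulr.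
rewrite -natr1 mulrDl mul1r; apply: lerD IH _.
set Y := (Z * 2 ^ J)%N in JJ *; set Y2 := (Z * 2 ^ J.+1)%N in JJ *.
have YE : Y2 = (2 * Y)%N by rewrite /Y2 /Y expnS mulnCA.
have Y0 : (0 : R) < Y%:R by rewrite ltr0n muln_gt0 Z0.
have lY : ln Z%:R <= ln Y2%:R :> R.
  by apply: ler_ln_nat; rewrite /Y2 leq_pmulr // expn_gt0.
apply: (@le_trans _ _ ((\sum_(1 <= m < Y2.+1 | squarefree m) itau R 1 m) / Y%:R)).
  rewrite (@big_cat_nat _ _ _ Y.+1 1 Y2.+1) //= mulrDl ler_wpDl //.
    by rewrite mulr_ge0 ?invr_ge0 // sumr_ge0 // => m _; apply: itau_ge0.
  rewrite mulr_suml big_nat_cond [leRHS]big_nat_cond.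
  apply: ler_sum => m /andP[/andP[Ym _] _]; apply: ler_wpM2l; first exact: itau_ge0.
  by rewrite lef_pV2 ?posrE // ?ltr0n ?ler_nat; lia.
rewrite ler_pdivrMr //.
apply: le_trans (squarefree_sum_itau1_le R Y2 (le_trans lZ lY)) _.
have -> : 12 / Num.sqrt (ln Z%:R) * Y%:R = 6 * Y2%:R / Num.sqrt (ln Z%:R) :> R.
  by rewrite YE natrM; ring.
apply: ler_wpM2l; first by rewrite mulr_ge0.
have lZ0 := lt_le_trans ltr01 lZ; have l0 := lt_le_trans lZ0 lY.
by rewrite lef_pV2 ?posrE ?sqrtr_gt0 // ler_wsqrtr.
Qed.

(** The sum is empty unless [n / K > Z]; in that case [ln (n / K)] can be replaced by [ln Z], so the
    saving is uniform in [K]. *)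
Lemma truncated_sum_le (R : realType) (n Z Y K : nat) : 1 <= ln Z%:R :> R -> (0 < K)%N ->
  \sum_(Z.+1 <= d < Y.+1 | squarefree d) itau R 1 d * (K * d <= n)%N%:R <=
  6 * (n%:R / K%:R) / Num.sqrt (ln Z%:R).
Proof.
move=> lZ K0; have q0 : 0 < Num.sqrt (ln Z%:R) :> R by rewrite sqrtr_gt0 (lt_le_trans _ lZ).
have KR : (0 : R) < K%:R by rewrite ltr0n.
have [nZ|Zn] := leqP (n %/ K)%N Z.
  rewrite big_nat_cond big1 ?mulr_ge0 ?invr_ge0 ?sqrtr_ge0 // => d /andP[/andP[Zd _] _].
  by rewrite mulnC -leq_divRL // leqNgt (leq_ltn_trans nZ Zd) mulr0.
set N := (n %/ K)%N in Zn.
have lN : ln Z%:R <= ln N%:R :> R by apply: ler_ln_nat; apply: ltnW.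
apply: (@le_trans _ _ (\sum_(1 <= d < N.+1 | squarefree d) itau R 1 d)).
  have -> : \sum_(Z.+1 <= d < Y.+1 | squarefree d) itau R 1 d * (K * d <= n)%N%:R =
     \sum_(d <- [seq d <- index_iota Z.+1 Y.+1 | squarefree d && (K * d <= n)%N]) itau R 1 d.
    rewrite big_filter big_mkcond [RHS]big_mkcond; apply: eq_bigr => d _.
    by case: (squarefree d); case: (K * d <= n)%N; rewrite /= ?mulr1 ?mulr0.
  rewrite -[leRHS]big_filter; apply: ler_sum_subset; first by rewrite filter_uniq ?iota_uniq.
    move=> d; rewrite !mem_filter !mem_index_iota => /andP[/andP[-> h] /andP[Zd _]] /=.
    by rewrite (leq_ltn_trans _ Zd) //= ltnS leq_divRL // mulnC.
  by move=> d; apply: itau_ge0.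
apply: le_trans (squarefree_sum_itau1_le R N (le_trans lZ lN)) _.
apply: ler_pM; rewrite ?mulr_ge0 ?invr_ge0 ?sqrtr_ge0 //.
  by rewrite ler_pM2l // ler_pdivlMr // -natrM ler_nat leq_divM.
have lZ0 := lt_le_trans ltr01 lZ; have l0 := lt_le_trans lZ0 lN.
by rewrite lef_pV2 ?posrE ?sqrtr_gt0 // ler_wsqrtr.
Qed.

(* If [tau 1 a < T], then [T * quad_weight R M Z Y a] is at least 1 as soon as
   [a = r * (b * c * d)] with [r <= M ^ 6] and [b], [c], [d] in the window
   (Z, Y]; dividing by [tau 1] makes the sum over [a] small. *)
Definition quad_weight (R : realType) (M Z Y a : nat) : R :=
  \sum_(1 <= r < (M ^ 6).+1) \sum_(Z.+1 <= b < Y.+1 | squarefree b)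
  \sum_(Z.+1 <= c < Y.+1 | squarefree c) \sum_(Z.+1 <= d < Y.+1 | squarefree d)
    itau R 1 b * itau R 1 c * itau R 1 d * (a == r * (b * c * d))%N%:R.

Lemma quad_weight_ge0 (R : realType) M Z Y a : 0 <= quad_weight R M Z Y a.
Proof. by do 4 apply: sumr_ge0 => ? _; rewrite !mulr_ge0 ?itau_ge0. Qed.

Lemma sum_eqn_le (R : realType) (n k : nat) :
  \sum_(1 <= a < n.+1) (a == k)%:R <= (k <= n)%N%:R :> R.
Proof.
have [kn|nk] := boolP (k \in index_iota 1 n.+1).
  rewrite (bigD1_seq k) ?iota_uniq //= eqxx big1 ?addr0; last by move=> a /negbTE->.
  by move: kn; rewrite mem_index_iota ltnS => /andP[_ ->].
rewrite big_seq big1 // => a ai; case: eqP => // ak.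
by rewrite -ak ai in nk.
Qed.

(** Summing over [d] first saves one square root of [ln Z]; the logarithmic sums over [b] and [c]
    save one each, and [r] costs a harmonic sum. The constant is [864 = 6 * 12 * 12]. *)
Lemma sum_quad_weight_le (R : realType) (n M Z J : nat) : 1 <= ln Z%:R :> R -> (0 < M)%N ->
  \sum_(1 <= a < n.+1) quad_weight R M Z (Z * 2 ^ J) a <=
  864 * n%:R * (1 + 6 * ln M%:R) * J%:R ^+ 2 / Num.sqrt (ln Z%:R) ^+ 3.
Proof.
move=> lZ M0; set Y := (Z * 2 ^ J)%N; set q := Num.sqrt _.
have q0 : 0 < q by rewrite sqrtr_gt0 (lt_le_trans _ lZ).
set W := \sum_(Z.+1 <= m < Y.+1 | squarefree m) itau R 1 m / m%:R.
have HW : W <= J%:R * (12 / q) by apply: window_log_sum_le.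
have W0 : 0 <= W by apply: sumr_ge0 => *; rewrite mulr_ge0 ?itau_ge0 ?invr_ge0.
apply: (@le_trans _ _ (\sum_(1 <= r < (M ^ 6).+1) \sum_(Z.+1 <= b < Y.+1 | squarefree b)
  \sum_(Z.+1 <= c < Y.+1 | squarefree c)
    6 * n%:R / q * (r%:R^-1 * (itau R 1 b / b%:R) * (itau R 1 c / c%:R)))).
  rewrite exchange_big /= big_nat [leRHS]big_nat; apply: ler_sum => r /andP[r0 _].
  rewrite exchange_big /= big_nat_cond [leRHS]big_nat_cond; apply: ler_sum => b /andP[/andP[Zb _] _].
  rewrite exchange_big /= big_nat_cond [leRHS]big_nat_cond; apply: ler_sum => c /andP[/andP[Zc _] _].
  rewrite exchange_big /=.
  have K0 : (0 < r * b * c)%N by rewrite !muln_gt0 r0 (leq_trans _ Zb) // (leq_trans _ Zc).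
  have := truncated_sum_le R n Z Y (r * b * c) lZ K0; rewrite -/q => T.
  have ibc : 0 <= itau R 1 b * itau R 1 c by rewrite mulr_ge0 ?itau_ge0.
  have := ler_wpM2l ibc T => {}T.
  apply: (@le_trans _ _ (itau R 1 b * itau R 1 c * (6 * (n%:R / (r * b * c)%:R) / q))); last first.
    by rewrite !natrM !invfM le_eqVlt; apply/orP; left; apply/eqP; ring.
  apply: le_trans T; rewrite mulr_sumr; apply: ler_sum => d _.
  rewrite -mulr_sumr mulrA ler_wpM2l ?mulr_ge0 ?itau_ge0 //.
  by rewrite (_ : r * b * c * d = r * (b * c * d))%N ?sum_eqn_le // -!mulnA.
have -> : \sum_(1 <= r < (M ^ 6).+1) \sum_(Z.+1 <= b < Y.+1 | squarefree b)
  \sum_(Z.+1 <= c < Y.+1 | squarefree c)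
    6 * n%:R / q * (r%:R^-1 * (itau R 1 b / b%:R) * (itau R 1 c / c%:R)) =
  6 * n%:R / q * ((\sum_(1 <= r < (M ^ 6).+1) r%:R^-1) * W * W).
  rewrite !mulr_suml mulr_sumr; apply: eq_bigr => r _.
  have WV V : \sum_(Z.+1 <= b < Y.+1 | squarefree b)
      6 * n%:R / q * (r%:R^-1 * (itau R 1 b / b%:R) * V) = 6 * n%:R / q * (r%:R^-1 * W * V).
    by rewrite /W mulr_sumr mulr_suml mulr_sumr.
  by rewrite -WV; apply: eq_bigr => b _; rewrite /W !mulr_sumr.
set H := \sum_(_ <= _ < _) _.
have HH : H <= 1 + 6 * ln M%:R.
  apply: le_trans (harmonic_le R _ _) _; first by rewrite expn_gt0 M0.
  by rewrite natrX lnXn ?ltr0n // mulr_natl.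
have H0 : 0 <= H by apply: sumr_ge0 => *; rewrite invr_ge0.
have -> : 864 * n%:R * (1 + 6 * ln M%:R) * J%:R ^+ 2 / q ^+ 3 =
  6 * n%:R / q * ((1 + 6 * ln M%:R) * (J%:R * (12 / q)) * (J%:R * (12 / q))).
  by field; rewrite gt_eqF.
apply: ler_wpM2l; first by rewrite !mulr_ge0 ?invr_ge0 // ltW.
by do 2 (apply: ler_pM => //; rewrite ?mulr_ge0 //).
Qed.

(* Each summand bounds the indicator of one class of discarded integers; the
   set constructed below consists of the [a] with [badness R n M Z Y T a < 1]. *)
Definition badness (R : realType) (n M Z Y : nat) (T : R) (a : nat) : R :=
  (a * M < n)%N%:R + \sum_(M.+1 <= m < n.+1) (m ^ 2 %| a)%N%:R + (tau 1 a)%:R / T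
  + T * quad_weight R M Z Y a.

Lemma sum_badness_le (R : realType) (n M Z J : nat) (T : R) :
  (0 < M)%N -> 0 < T -> 1 <= ln Z%:R :> R ->
  \sum_(1 <= a < n.+1) badness R n M Z (Z * 2 ^ J) T a <=
  2 * (n%:R / M%:R) + n%:R * (1 + ln n%:R) / T +
  T * (864 * n%:R * (1 + 6 * ln M%:R) * J%:R ^+ 2 / Num.sqrt (ln Z%:R) ^+ 3).
Proof.
move=> M0 T0 lZ; rewrite /badness !big_split /= -mulr_suml -mulr_sumr.
have M0R : (0 : R) < M%:R by rewrite ltr0n.
apply: lerD; last by rewrite ler_pM2l // sum_quad_weight_le.
apply: lerD; last by rewrite ler_pM2r ?invr_gt0 // sum_tau1_le.
rewrite mulr2n mulrDl mul1r; apply: lerD.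
  apply: (@le_trans _ _ (n %/ M)%N%:R); last first.
    by rewrite ler_pdivlMr // -natrM ler_nat leq_divM.
  apply: (@le_trans _ _ (\sum_(1 <= a < n.+1 | (a <= n %/ M)%N) 1)).
    rewrite [leRHS]big_mkcond; apply: ler_sum => a _.
    case: (leqP a (n %/ M)) => [_|]; first by rewrite lern1 leq_b1.
    rewrite ltnNge leq_divRL // -ltnNge => h.
    by rewrite ltnNge ltnW.
  rewrite -big_filter; apply: (@le_trans _ _ (\sum_(a <- index_iota 1 (n %/ M).+1) 1)).
    apply: ler_sum_subset => //; first by rewrite filter_uniq ?iota_uniq.
    by move=> a; rewrite mem_filter !mem_index_iota => /andP[h /andP[-> _]]; rewrite ltnS.
  by rewrite big_const_nat iter_addr_0 subn1.
rewrite exchange_big /=.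
apply: le_trans (_ : \sum_(M.+1 <= m < n.+1) n%:R * (m%:R ^+ 2)^-1 <= _).
  rewrite big_nat [leRHS]big_nat; apply: ler_sum => m /andP[Mm _].
  by rewrite -natrX sum_dvdn_le // expn_gt0 (leq_trans _ Mm).
by rewrite -mulr_sumr ler_wpM2l // sum_inv_squares_le.
Qed.

(** The single term at [(r, b, c, d)] suffices: squarefreeness makes [b], [c], [d] coprime, so it
    equals [itau R 1 (b * c * d)], and the factor [r] can only lower [itau]. *)
Lemma quad_weight_ge (R : realType) (M Z Y r b c d : nat) :
  (0 < r <= M ^ 6)%N -> (Z < b <= Y)%N -> (Z < c <= Y)%N -> (Z < d <= Y)%N ->
  squarefree (b * c * d) ->
  itau R 1 (r * (b * c * d)) <= quad_weight R M Z Y (r * (b * c * d)).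
Proof.
move=> /andP[r0 rM] /andP[b0 bY] /andP[c0 cY] /andP[d0 dY] s.
have bp : (0 < b)%N by apply: leq_trans b0.
have cp : (0 < c)%N by apply: leq_trans c0.
have dp : (0 < d)%N by apply: leq_trans d0.
have s' : squarefree (b * c).
  by apply: squarefree_dvd s; rewrite ?muln_gt0 ?bp ?cp // dvdn_mulr.
have sb : squarefree b by apply: squarefree_dvd s'; rewrite ?muln_gt0 ?bp // dvdn_mulr.
have sc : squarefree c by apply: squarefree_dvd s'; rewrite ?muln_gt0 ?bp // dvdn_mull.
have sd : squarefree d by apply: squarefree_dvd s; rewrite ?muln_gt0 ?bp ?cp // dvdn_mull.
apply: (@le_trans _ _ (itau R 1 b * itau R 1 c * itau R 1 d *
    (r * (b * c * d) == r * (b * c * d))%N%:R)).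
  rewrite eqxx mulr1 -itauM_coprime ?squarefree_coprime // -itauM_coprime ?muln_gt0 ?bp //.
    by apply: itau_dvd_le; [rewrite !muln_gt0 r0 bp cp dp|apply: dvdn_mull].
  by rewrite squarefree_coprime ?muln_gt0 ?bp.
rewrite /quad_weight; set a := (X in itau R 1 b * _ * _ * (X == _)%:R).
have nn r' b' c' d' : 0 <= itau R 1 b' * itau R 1 c' * itau R 1 d' * (a == r' * (b' * c' * d'))%N%:R.
  by rewrite !mulr_ge0 ?itau_ge0.
apply: le_trans (ler_term_sum R _ _ xpredT _ r _ _ _) => //; first last.
- by move=> *; do 3 apply: sumr_ge0 => ? _.
- by rewrite mem_index_iota r0 ltnS.
apply: le_trans (ler_term_sum R _ _ _ _ b _ _ _) => //; first last.
- by move=> *; do 2 apply: sumr_ge0 => ? _.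
- by rewrite mem_index_iota b0 ltnS.
apply: le_trans (ler_term_sum R _ _ _ _ c _ _ _) => //; first last.
- by move=> *; apply: sumr_ge0 => ? _.
- by rewrite mem_index_iota c0 ltnS.
apply: le_trans (ler_term_sum R _ _ _ _ d _ _ _) => //.
by rewrite mem_index_iota d0 ltnS.
Qed.

(** All four summands are nonnegative, so each is below 1. The third then gives [tau 1 a < T], so a
    factorization in the window would push the fourth above 1. *)
Lemma badness_lt1 (R : realType) (n M Z Y : nat) (T : R) (a : nat) :
  (0 < a <= n)%N -> 0 < T -> badness R n M Z Y T a < 1 ->
  [/\ (n <= a * M)%N, forall m, (m ^ 2 %| a)%N -> (m <= M)%N &
   forall r b c d, a = (r * (b * c * d))%N -> (r <= M ^ 6)%N -> squarefree (b * c * d) ->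
    (Z < b <= Y)%N -> (Z < c <= Y)%N -> (Z < d <= Y)%N -> False].
Proof.
move=> /andP[a0 an] T0; rewrite /badness.
set p1 := _%:R; set p2 := \sum_(_ <= _ < _) _; set p3 := _ / T; set p4 := T * _.
have p10 : 0 <= p1 by [].
have p20 : 0 <= p2 by apply: sumr_ge0.
have p30 : 0 <= p3 by rewrite divr_ge0 // ltW.
have p40 : 0 <= p4 by rewrite mulr_ge0 ?quad_weight_ge0 // ltW.
move=> lt1; split.
- have : p1 < 1 by lra.
  by rewrite /p1 ltrn1 ltnS leqn0 eqb0 -leqNgt.
- move=> m ma; rewrite leqNgt; apply/negP => Mm.
  have : 1 <= p2; last lra.
  have mn : (m <= n)%N.
    apply: leq_trans an; apply: leq_trans (dvdn_leq a0 ma).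
    by case: m {ma Mm} => // m; rewrite expnS expn1 leq_pmulr.
  apply: le_trans (ler_term_sum R _ _ xpredT _ m _ _ _) => //; first by rewrite ma.
  by rewrite mem_index_iota Mm ltnS.
- move=> r b c d E rM s hb hc hd.
  have r0 : (0 < r)%N by move: a0; rewrite E muln_gt0 => /andP[].
  have ta : (0 : R) < (tau 1 a)%:R by rewrite ltr0n tau_gt0.
  have : (tau 1 a)%:R < T by rewrite -[T]mul1r -ltr_pdivrMr // -/p3; lra.
  have : p4 < 1 by lra.
  have := quad_weight_ge R M Z Y r b c d; rewrite r0 rM hb hc hd -E => /(_ isT isT isT isT s).
  rewrite /itau => h1 h2 h3; have : T * (tau 1 a)%:R^-1 < 1.
    by apply: le_lt_trans h2; rewrite ler_pM2l.
  by rewrite ltr_pdivrMr // mul1r => /(lt_trans h3); rewrite ltxx.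
Qed.

Lemma exists_cubefree_set (R : realType) (n M Z J : nat) (T : R) :
  (0 < n)%N -> (0 < M)%N -> 0 < T -> 1 <= ln Z%:R :> R ->
  (forall b, (n <= b ^ 3 * (M ^ 7) ^ 7)%N -> (b ^ 3 <= n * (M ^ 7) ^ 2)%N ->
     (Z < b <= Z * 2 ^ J)%N) ->
  exists A : {set 'I_n.+1}, [/\ ord0 \notin A, only_trivial_solutions 4 3 A &
    n%:R - #|A|%:R <= 2 * (n%:R / M%:R) + n%:R * (1 + ln n%:R) / T +
      T * (864 * n%:R * (1 + 6 * ln M%:R) * J%:R ^+ 2 / Num.sqrt (ln Z%:R) ^+ 3)].
Proof.
move=> n0 M0 T0 lZ win.
pose A := [set x : 'I_n.+1 | (x != ord0) && (badness R n M Z (Z * 2 ^ J) T x < 1)].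
have A0 : ord0 \notin A by rewrite inE eqxx.
exists A; split=> //; last first.
  rewrite -sum_complement //; apply: le_trans (sum_badness_le R n M Z J T M0 T0 lZ).
  rewrite big_nat [leRHS]big_nat; apply: ler_sum => a /andP[a0 an].
  have aK : (inord a : 'I_n.+1) = a :> nat by rewrite inordK.
  have b0 : 0 <= badness R n M Z (Z * 2 ^ J) T a.
    by rewrite !addr_ge0 ?mulr_ge0 ?invr_ge0 ?quad_weight_ge0 ?sumr_ge0 // ltW.
  rewrite inE -val_eqE /= aK -lt0n a0 /= -leNgt.
  by case: (leP 1 (badness R n M Z (Z * 2 ^ J) T a)).
(* No solution at all exists in [A], so the triviality requirement holds vacuously. *)
move=> a aA [x E]; exfalso.
have good i : (0 < a i <= n)%N /\ badness R n M Z (Z * 2 ^ J) T (a i) < 1.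
  have := aA i; rewrite inE -val_eqE /= -lt0n => /andP[-> ->].
  by rewrite -ltnS ltn_ord.
have {}E : (\prod_(i < 4) a i = `|x| ^ 3)%N by rewrite -abszX -E.
rewrite !big_ord_recl big_ord0 muln1 !mulnA in E.
move: (good ord0) (good (lift ord0 ord0)) (good (lift ord0 (lift ord0 ord0)))
  (good (lift ord0 (lift ord0 (lift ord0 ord0)))) E.
move: (nat_of_ord (a ord0)) (nat_of_ord (a (lift ord0 ord0)))
 (nat_of_ord (a (lift ord0 (lift ord0 ord0))))
 (nat_of_ord (a (lift ord0 (lift ord0 (lift ord0 ord0))))) => a1 a2 a3 a4.
move=> [h1 g1] [h2 g2] [h3 g3] [h4 g4] E.
have [n1 q1 f1] := badness_lt1 _ _ _ _ _ _ _ h1 T0 g1.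
have [n2 q2 _] := badness_lt1 _ _ _ _ _ _ _ h2 T0 g2.
have [n3 q3 _] := badness_lt1 _ _ _ _ _ _ _ h3 T0 g3.
have [n4 q4 _] := badness_lt1 _ _ _ _ _ _ _ h4 T0 g4.
case/andP: h1 => p1 m1; case/andP: h2 => p2 m2; case/andP: h3 => p3 m3; case/andP: h4 => p4 m4.
have sq m : [|| m ^ 2 %| a1, m ^ 2 %| a2, m ^ 2 %| a3 | m ^ 2 %| a4]%N -> (m <= M)%N.
  by move=> /or4P[/q1|/q2|/q3|/q4].
have [r1 [r2 [r3 [r4 [w [b [c [d [[E1 E2 E3 E4] [s R1 R2 R3 R4]]]]]]]]]] :=
  cube_four_factorization a1 a2 a3 a4 _ M p1 p2 p3 p4 sq E.
(* The triple product [u] loses a factor [M] from [ai >= n / M] and a factor [M ^ 6] from [r]; hence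
   the window parameter [M ^ 7]. *)
have bnd r u ai : (0 < ai <= n)%N -> (n <= ai * M)%N -> ai = (r * u)%N -> (r <= M ^ 6)%N ->
    (u <= n)%N /\ (n <= M ^ 7 * u)%N.
  move=> /andP[ai0 ain] nai Ei rM; split.
    by apply: leq_trans ain; rewrite Ei leq_pmull //; move: ai0; rewrite Ei muln_gt0 => /andP[].
  by apply: leq_trans nai _; rewrite Ei mulnAC leq_mul2r (expnSr M 6) leq_mul2r rM !orbT.
have [u1 v1] := bnd _ _ a1 (introT andP (conj p1 m1)) n1 E1 R1.
have [u2 v2] := bnd _ _ a2 (introT andP (conj p2 m2)) n2 E2 R2.
have [u3 v3] := bnd _ _ a3 (introT andP (conj p3 m3)) n3 E3 R3.
have [u4 v4] := bnd _ _ a4 (introT andP (conj p4 m4)) n4 E4 R4.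
have hb : (b ^ 3 <= n * (M ^ 7) ^ 2)%N.
  apply: (window_upper n _ b (w * c * d) (b * c * d) (w * b * d) (w * b * c)) => //.
  by clear; rewrite !expnS !expn0; lia.
have hc : (c ^ 3 <= n * (M ^ 7) ^ 2)%N.
  apply: (window_upper n _ c (w * b * d) (b * c * d) (w * c * d) (w * b * c)) => //.
  by clear; rewrite !expnS !expn0; lia.
have hd : (d ^ 3 <= n * (M ^ 7) ^ 2)%N.
  apply: (window_upper n _ d (w * b * c) (b * c * d) (w * c * d) (w * b * d)) => //.
  by clear; rewrite !expnS !expn0; lia.
apply: (f1 r1 b c d E1 R1 s); apply: win => //.
- by apply: window_lower hc hd v1.
- by apply: window_lower hb hd _ => //; rewrite [(c * b)%N]mulnC.
- by apply: window_lower hb hc _ => //; rewrite (_ : d * b * c = b * c * d)%N // -mulnA mulnC.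
Qed.

(** * Comparison of the two extremal functions *)

Lemma only_trivial_no_increasing (n : nat) (A : {set 'I_n.+1}) :
  only_trivial_solutions 4 3 A -> no_increasing_solution 4 3 A.
Proof.
move=> hA a aA _ ca; have [P [pP hP]] := hA a aA ca.
have cP : {in P, forall B : {set 'I_4}, #|B| = 3%N} by move=> B /hP[].
(* A partition of the four indices into triples would make 4 a multiple of 3. *)
have := card_uniform_partition cP pP; rewrite cardsT card_ord.
by case: #|P| => [|[|p]].
Qed.

Lemma f_le_F (n : nat) : (f 4 3 n <= F 4 3 n)%N.
Proof.
apply/bigmax_leqP => A /andP[A0 /asboolP hA].
apply: (@leq_bigmax_cond _ _ (fun A : {set 'I_n.+1} => #|A|) A); rewrite A0 /=.
exact/asboolP/only_trivial_no_increasing.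
Qed.

Lemma F_attained (n : nat) : exists A : {set 'I_n.+1},
  [/\ ord0 \notin A, no_increasing_solution 4 3 A & F 4 3 n = #|A|].
Proof.
pose good := [pred A : {set 'I_n.+1} | (ord0 \notin A) && `[< no_increasing_solution 4 3 A >]].
have good0 : (0 < #|good|)%N.
  apply/card_gt0P; exists set0; rewrite !inE /=.
  by apply/asboolP => a /(_ ord0); rewrite inE.
have [A /andP[A0 /asboolP hA] E] := @eq_bigmax_cond _ good (fun A => #|A|) good0.
by exists A.
Qed.

Lemma card_le_f (n : nat) (A : {set 'I_n.+1}) :
  ord0 \notin A -> only_trivial_solutions 4 3 A -> (#|A| <= f 4 3 n)%N.
Proof.
move=> A0 hA; apply: (@leq_bigmax_cond _ _ (fun A : {set 'I_n.+1} => #|A|) A); rewrite A0 /=.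
exact/asboolP.
Qed.

(** * Choice of the window *)

Lemma polynomial_le_exp2 (c k : nat) :
  exists M0 : nat, forall M : nat, (M0 <= M)%N -> (c * M ^ k <= 2 ^ M)%N.
Proof.
(* With [q = floor (M / (k + 1))], both the constant and [M ^ k] are absorbed by [(q + 1) ^ (k + 1)
   <= 2 ^ (q * (k + 1)) <= 2 ^ M]. *)
exists (k.+1 * (c * k.+1 ^ k))%N => M hM; pose q := (M %/ k.+1)%N.
have hq : (c * k.+1 ^ k <= q)%N by rewrite leq_divRL // mulnC.
apply: leq_trans (_ : c * (k.+1 * q.+1) ^ k <= _)%N.
  rewrite leq_mul2l; apply/orP; right; case: (posnP k) => [->|k0]; first by rewrite !expn0.
  by rewrite leq_exp2r // mulnC ltnW // ltn_ceil.
rewrite expnMn mulnA; apply: leq_trans (_ : q.+1 ^ k.+1 <= _)%N.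
  by rewrite expnS leq_mul2r (leqW hq) orbT.
apply: leq_trans (_ : (2 ^ q) ^ k.+1 <= _)%N; first by rewrite leq_exp2r // ltn_expl.
by rewrite -expnM leq_exp2l // leq_divM.
Qed.

(* In a solution made of integers in [n / M, n], the common factors [b] lie
   between (n / Q ^ 7) ^ (1/3) and (n * Q ^ 2) ^ (1/3) with [Q = M ^ 7]: a
   window whose end points have ratio at most [Q ^ 3]. *)
Lemma window_parameters (n M K : nat) : (2 ^ M <= n)%N -> (0 < M)%N ->
  (4096 * M ^ 196 <= 2 ^ M)%N -> (M <= 2 ^ K)%N ->
  exists Z : nat, (n <= Z ^ 4)%N /\
   forall b, (n <= b ^ 3 * (M ^ 7) ^ 7)%N -> (b ^ 3 <= n * (M ^ 7) ^ 2)%N ->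
     (Z < b <= Z * 2 ^ (21 * K).+1)%N.
Proof.
move=> Mn M0 big MK.
have n0 : (0 < n)%N by apply: leq_trans Mn; rewrite expn_gt0.
have ex : exists X, (n <= X ^ 3 * (M ^ 7) ^ 7)%N.
  exists n; rewrite -{1}[n]muln1 leq_mul // ?expn_gt0 ?M0 //.
  by rewrite -{1}(expn1 n) leq_pexp2l.
case: (ex_minnP ex) => X hX minX.
have X1 : (1 < X)%N.
  rewrite ltnNge; apply/negP => X1.
  have : (n <= M ^ 49)%N.
    apply: leq_trans hX _; rewrite -expnM -[leqRHS]mul1n leq_mul2r.
    by case: X X1 {minX} => [|[|]] //; rewrite orbT.
  rewrite leqNgt; apply/negP/negPn; apply: leq_trans (leq_trans big Mn).
  apply: leq_trans (_ : 4096 * M ^ 49 <= _)%N; last by rewrite leq_mul2l leq_pexp2l // orbT.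
  by rewrite ltn_Pmull // expn_gt0 M0.
(* Minimality of [X] puts every admissible [b] at or above [X], so [Z = X - 1] serves as the strict
   lower end. *)
exists X.-1; have XZ : (X <= 2 * X.-1)%N by lia.
split.
  rewrite leqNgt; apply/negP => Zn.
  (* Fourth power of [n <= X ^ 3 * M ^ 49] with [X <= 2 Z]: this explains [4096 = 2 ^ 12] and
     [196 = 4 * 49]. *)
  have : (n ^ 4 < 4096 * n ^ 3 * M ^ 196)%N.
    apply: leq_ltn_trans (_ : (X ^ 3 * (M ^ 7) ^ 7) ^ 4 < _)%N; first by rewrite leq_exp2r.
    rewrite expnMn -!expnM ltn_pmul2r ?expn_gt0 ?M0 //.
    apply: leq_ltn_trans (_ : (2 * X.-1) ^ (3 * 4) < _)%N; first by rewrite leq_exp2r.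
    rewrite expnMn (_ : 2 ^ (3 * 4) = 4096)%N // ltn_pmul2l // (mulnC 3) expnM ltn_exp2r //.
  rewrite expnS mulnAC ltn_pmul2r ?expn_gt0 ?n0 // ltnNge.
  by rewrite (leq_trans big Mn).
move=> b b1 b2; have Xb : (X <= b)%N by apply: minX.
apply/andP; split; first by rewrite prednK // ltnW.
have : (b <= X * (M ^ 7) ^ 3)%N.
  rewrite -(@leq_exp2r _ _ 3) //; apply: leq_trans b2 _.
  apply: leq_trans (leq_mul hX (leqnn _)) _.
  by rewrite expnMn -mulnA -expnD -[((_ ^ 3) ^ 3)%N]expnM.
(* The ratio [Q ^ 3 = M ^ 21] takes [21 K] doublings, and passing from [X] to [Z] takes one more. *)
move=> /leq_trans; apply; rewrite -expnM expnS mulnA; apply: leq_mul.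
  by rewrite mulnC.
by rewrite -[(7 * 3)%N]/21%N (mulnC 21%N K) expnM leq_exp2r.
Qed.

(** * Numerical bounds for the exponent *)

Lemma expR1_ge (R : realType) : 26 / 10 <= expR 1 :> R.
Proof.
have h : 12 / 11 <= expR (1 / 11) :> R by apply: le_trans (expR_ge1Dx _); lra.
have -> : 1 = 11%:R * (1 / 11) :> R by field.
rewrite expRM_natl; apply: (@le_trans _ _ ((12 / 11) ^+ 11)); first by clear; lra.
by rewrite ler_pXn2r ?nnegrE ?expR_ge0 // divr_ge0.
Qed.

Lemma ln3_ge (R : realType) : 107 / 100 <= ln 3 :> R.
Proof.
have h : 9665 / 10000 <= expR (- (335 / 10000)) :> R.
  by apply: le_trans (expR_ge1Dx _); lra.
(* Here [32 * 0.0335 = 1.072], and [0.9665 ^ 32] still exceeds [1 / 3]. *)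
apply: (@le_trans _ _ (32%:R * (335 / 10000))); first lra.
rewrite -ler_expR lnK ?posrE // -[leLHS]invrK -expRN invf_ple ?posrE ?expR_gt0 //.
rewrite -mulrN expRM_natl; apply: (@le_trans _ _ ((9665 / 10000) ^+ 32)); first by clear; lra.
by rewrite ler_pXn2r ?nnegrE ?expR_ge0 // divr_ge0.
Qed.

(** This makes [1 - e log 3 / (2 sqrt 3)] at most [1 / 5], the exponent reached by the construction.
    The margin is narrow: [2.6 * 1.07 = 2.782] against [0.8 * 2 * 1.733 = 2.7728]. *)
Lemma exponent_ge (R : realType) : 4 / 5 <= expR 1 * ln 3 / (2 * Num.sqrt 3) :> R.
Proof.
have s3 : Num.sqrt 3 <= 1733 / 1000 :> R.
  rewrite -[leRHS](ger0_norm (_ : 0 <= _)) ?divr_ge0 // -sqrtr_sqr ler_wsqrtr //; lra.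
rewrite ler_pdivlMr ?mulr_gt0 ?sqrtr_gt0 //.
apply: (@le_trans _ _ (26 / 10 * (107 / 100))); first lra.
by apply: ler_pM; rewrite ?divr_ge0 ?expR1_ge ?ln3_ge.
Qed.

(** * Size of the error terms *)

Lemma ln_trunc_log (R : realType) (m : nat) : (0 < m)%N ->
  (trunc_log 2 m)%:R * ln 2 <= ln m%:R :> R /\ ln m%:R <= (trunc_log 2 m).+1%:R * ln 2 :> R.
Proof.
move=> m0; have P k : k%:R * ln 2 = ln (2 ^ k)%N%:R :> R by rewrite mulr_natl -lnXn // natrX.
rewrite !P; split; apply: ler_ln_nat; first exact: trunc_logP.
by apply: ltnW; apply: trunc_log_ltn.
Qed.

(* Here [t = ln n], [w = t `^ (1 / 4)] and [u = t `^ (1 / 80)], so that all the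
   fractional powers of [t] become integral powers of [u] and [w]. *)
Lemma upper_bound_calculus (R : realType) (c1 c2 n m t w u l j s : R) :
  0 < n -> 0 < c1 -> 0 < c2 -> 6 + 864 * c1 * c2 ^+ 2 * 8 < u -> 1 < w -> t = w ^+ 4 -> t <= 2 * m ->
  0 <= l -> l <= c1 * u -> 0 <= j -> j <= c2 * u -> w ^+ 2 / 2 <= s ->
  2 * (n / m) + n * (1 + t) / w ^+ 5 + w ^+ 5 * (864 * n * l * j ^+ 2 / s ^+ 3) < n * (u ^+ 4 / w).
Proof.
move=> n0 c10 c20 cu w1 tE tm l0 lc j0 jc sw.
have w0 : 0 < w by apply: lt_trans w1.
have C0 : 0 < 864 * c1 * c2 ^+ 2 * 8 by rewrite !mulr_gt0 ?exprn_gt0.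
have u6 : 6 < u by apply: lt_trans cu; rewrite ltrDl.
have u0 : 0 < u by lra.
have w41 : 1 <= w ^+ 3 by rewrite exprn_ege1 // ltW.
have w4 : w <= w ^+ 4 by rewrite [leRHS]exprS ler_peMr // ltW.
have m0 : 0 < m.
  by have : 0 < t by [rewrite tE exprn_gt0 |]; lra.
(* With [T = w ^+ 5] the three terms are at most [4], [2] and a constant times [u ^+ 3], in units of
   [n / w]; the lower bound on [u] lets [u ^+ 4] exceed their sum. *)
have A1 : 2 * (n / m) <= 4 * (n / w).
  have : n / m <= n / (w / 2); last first.
    by rewrite invfM invrK; lra.
  by rewrite ler_pM2l // lef_pV2 ?posrE ?divr_gt0 //; lra.
have A2 : n * (1 + t) / w ^+ 5 <= 2 * (n / w).
  have -> : 2 * (n / w) = n * (2 * w ^+ 4) / w ^+ 5 by field; rewrite gt_eqF.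
  rewrite ler_pM2r ?invr_gt0 ?exprn_gt0 // ler_pM2l // tE.
  by have := exprn_ege1 4 (ltW w1); lra.
have A3 : w ^+ 5 * (864 * n * l * j ^+ 2 / s ^+ 3) <= 864 * c1 * c2 ^+ 2 * 8 * u ^+ 3 * (n / w).
  have -> : 864 * c1 * c2 ^+ 2 * 8 * u ^+ 3 * (n / w) =
     w ^+ 5 * (864 * n * (c1 * u) * (c2 * u) ^+ 2 / (w ^+ 2 / 2) ^+ 3) by field; rewrite gt_eqF.
  have h0 : 0 < w ^+ 2 / 2 by rewrite divr_gt0 ?exprn_gt0.
  have s0 : 0 < s by apply: lt_le_trans sw.
  rewrite ler_pM2l ?exprn_gt0 //; apply: ler_pM; rewrite ?invr_ge0 ?exprn_ge0 ?(ltW s0) //.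
  - by rewrite !mulr_ge0 ?exprn_ge0 // ltW.
  - apply: ler_pM; rewrite ?exprn_ge0 // ?mulr_ge0 ?(ltW n0) //.
      by rewrite ler_pM2l // mulr_gt0.
    by rewrite ler_pXn2r // nnegrE ?mulr_ge0 // ltW.
  - by rewrite lef_pV2 ?posrE ?exprn_gt0 // ler_pXn2r // nnegrE ltW.
have nw : 0 < n / w by rewrite divr_gt0.
have -> : n * (u ^+ 4 / w) = u ^+ 4 * (n / w) by rewrite mulrCA.
have u3 : 1 <= u ^+ 3 by rewrite exprn_ege1 //; lra.
have : (6 + 864 * c1 * c2 ^+ 2 * 8 * u ^+ 3) * (n / w) < u ^+ 4 * (n / w).
  rewrite ltr_pM2r //; apply: (@le_lt_trans _ _ ((6 + 864 * c1 * c2 ^+ 2 * 8) * u ^+ 3)).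
    by rewrite [leRHS]mulrDl lerD2r; lra.
  by rewrite [u ^+ 4]exprS ltr_pM2r // (lt_le_trans ltr01 u3).
rewrite [X in X < _ -> _]mulrDl; lra.
Qed.

(** Take [u] to be the 80th root of [t] and [w = u ^+ 20]. The factor [u ^+ 4] is the gap [1 / 20]
    between the exponents [1 / 4] and [1 / 5]. *)
Lemma power_substitution (R : realType) (C t : R) : 1 < C -> C ^+ 80 < t ->
  exists u w : R, [/\ C < u, 1 < w, t = w ^+ 4, ln t = 80 * ln u & t `^ (1 / 5) = w / u ^+ 4].
Proof.
move=> C1 Ct; have C0 : 0 < C by apply: lt_trans C1.
have t0 : 0 < t by apply: lt_trans Ct; rewrite exprn_gt0.
pose u := t `^ (1 / 80).
have uk k : u ^+ k = t `^ (k%:R / 80).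
  by rewrite -powR_mulrn ?powR_ge0 // -powRrM mulrC mulrA mulr1.
have u80 : u ^+ 80 = t by rewrite uk divff ?powRr1 ?pnatr_eq0 // ltW.
have u0 : 0 < u by rewrite powR_gt0.
have uC : C < u by rewrite -(@ltr_pXn2r _ 80) ?nnegrE ?ltW ?u80.
exists u, (u ^+ 20); split=> //.
- by rewrite exprn_egt1 // (lt_trans C1).
- by rewrite -exprM.
- by rewrite -u80 lnXn // [RHS]mulr_natl.
- have -> : t `^ (1 / 5) = u ^+ 16 by rewrite uk; congr (_ `^ _); field.
  by field; rewrite gt_eqF.
Qed.

Lemma ln_fourth_root_le (R : realType) (n Z : nat) : (n <= Z ^ 4)%N ->
  ln n%:R / 4 <= ln Z%:R :> R.
Proof.
move=> nZ; rewrite ler_pdivrMr // mulrC; apply: le_trans (ler_ln_nat R _ _ nZ) _.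
have [->|Z0] := posnP Z; first by rewrite exp0n // ln0 // mulr0.
by rewrite natrX lnXn ?ltr0n // [leRHS]mulr_natl.
Qed.

(** The parameter [M] is of order [ln n], so [ln M] and the number of doublings are [O(ln (ln n))],
    which [ln u < u] turns into [O(u)]. *)
Lemma trunc_log_estimates (R : realType) (n : nat) (u : R) :
  4 < ln n%:R :> R -> 6 < u -> ln (ln n%:R) = 80 * ln u :> R ->
  let M := trunc_log 2 n in
  [/\ ln n%:R <= 2 * M%:R :> R, 1 + 6 * ln M%:R <= 567 * u &
    (21 * (trunc_log 2 M).+1).+1%:R <= 5184 * u].
Proof.
move=> t4 u6 lt80 M.
have n0 : (0 < n)%N by case: n t4 {lt80 M} => // t4; rewrite ln0 // in t4; lra.
have l2 := ln2_le1 R; have l2' := ln2_ge_half R.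
have [Mt tM] := ln_trunc_log R n n0; rewrite -/M in Mt tM.
move: t4 lt80 Mt tM; set t := ln n%:R => t4 lt80 Mt tM.
have t0 : 0 < t by lra.
have tM2 : t <= 2 * M%:R.
  have : M.+1%:R * ln 2 <= M.+1%:R * 1 :> R by apply: ler_wpM2l.
  have : M.+1%:R = M%:R + 1 :> R by rewrite natr1.
  lra.
have MR : (0 : R) < M%:R by lra.
have Mpos : (0 < M)%N by rewrite ltr0n in MR.
have Mt2 : M%:R <= 2 * t.
  by have := ler_wpM2l (ltW MR) l2'; lra.
have lu : ln u < u by apply: ln_sublinear; lra.
have lM : ln M%:R <= 81 * u.
  have : ln M%:R <= ln (2 * t) by rewrite ler_ln ?posrE ?mulr_gt0.
  by rewrite lnM ?posrE //; lra.
have [KM _] := ln_trunc_log R M Mpos.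
have k0 : (0 : R) <= (trunc_log 2 M)%:R by [].
have KM2 := ler_wpM2l k0 l2'.
split=> //; first lra.
by rewrite -natr1 natrM -natr1; lra.
Qed.

Lemma complement_upper_bound (R : realType) :
  exists n0 : nat, forall n : nat, (n0 <= n)%N -> exists A : {set 'I_n.+1},
    [/\ ord0 \notin A, only_trivial_solutions 4 3 A &
      n%:R - #|A|%:R < n%:R / ln n%:R `^ (1 / 5) :> R].
Proof.
have [M0 bigM] := polynomial_le_exp2 4096 196.
have [c1 [c1E c10]] : exists c1 : R, c1 = 567 /\ 0 < c1 by exists 567.
have [c2 [c2E c20]] : exists c2 : R, c2 = 5184 /\ 0 < c2 by exists 5184.
have [C [CE C6]] : exists C : R, C = 6 + 864 * c1 * c2 ^+ 2 * 8 /\ 6 < C.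
  by eexists; split; first reflexivity; rewrite ltrDl !mulr_gt0 ?exprn_gt0.
have [n1 h1] := ln_eventually_gt R (C ^+ 80).
have [n3 h3] := ln_eventually_gt R 4.
exists (2 ^ M0.+1 + n1 + n3)%N => n hn.
have {}h3 := h3 n (leq_trans (leq_addl _ _) hn).
have {}hn := leq_trans (leq_addr _ _) hn.
have {}h1 := h1 n (leq_trans (leq_addl _ _) hn).
have n2 : (2 ^ M0.+1 <= n)%N := leq_trans (leq_addr _ _) hn.
have n0 : (0 < n)%N by apply: leq_trans n2; rewrite expn_gt0.
have C1 : 1 < C by apply: lt_trans C6; rewrite ltr1n.
have [u [w [uC w1 tE lt80 t5]]] := power_substitution R C _ C1 h1.
have w0 : 0 < w by apply: lt_trans w1.
have [] := trunc_log_estimates R n u h3 (lt_trans C6 uC) lt80.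
set M := trunc_log 2 n; set K := (trunc_log 2 M).+1; rewrite -c1E -c2E => tM lM JK.
have M1 : (M0.+1 <= M)%N by apply: trunc_log_max.
have Mpos : (0 < M)%N by apply: leq_trans M1.
have Mn : (2 ^ M <= n)%N by apply: trunc_logP.
have MK : (M <= 2 ^ K)%N by apply: ltnW; apply: trunc_log_ltn.
have [Z [nZ win]] := window_parameters n M K Mn Mpos (bigM M (ltnW M1)) MK.
have lZ4 := ln_fourth_root_le R n Z nZ.
have lZ : 1 <= ln Z%:R :> R by apply: le_trans lZ4; rewrite ler_pdivlMr // mul1r ltW.
have T0 : 0 < w ^+ 5 by rewrite exprn_gt0.
(* The threshold [T = w ^+ 5] is [(ln n) ^ (5 / 4)], which balances the loss from integers with many
   divisors against that from factorizations in the window. *)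
have [A [A0 hA bA]] := exists_cubefree_set R n M Z (21 * K).+1 (w ^+ 5) n0 Mpos T0 lZ win.
exists A; split=> //; apply: le_lt_trans bA _.
have -> : n%:R / ln n%:R `^ (1 / 5) = n%:R * (u ^+ 4 / w) by rewrite t5 invf_div.
apply: (upper_bound_calculus R c1 c2) => //.
- by rewrite ltr0n.
- by rewrite -CE.
- by rewrite addr_ge0 // mulr_ge0 // ln_nat_ge0.
- have -> : w ^+ 2 / 2 = Num.sqrt (ln n%:R / 4).
    have -> : ln n%:R / 4 = (w ^+ 2 / 2) ^+ 2 by rewrite tE; field.
    by rewrite sqrtr_sqr ger0_norm // divr_ge0 ?exprn_ge0 // ltW.
  by rewrite ler_wsqrtr.
Qed.

(** * The two bounds combined *)

Theorem theorem5 (R : realType) (eps : R) (eps_gt0 : 0 < eps) :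
  exists n0 : nat, forall n : nat, (n0 <= n)%N ->
    [/\ n%:R / (ln n%:R) `^ (2 + eps) < n%:R - (F 4 3 n)%:R :> R,
        n%:R - (F 4 3 n)%:R <= n%:R - (f 4 3 n)%:R :> R &
        n%:R - (f 4 3 n)%:R
          < n%:R / (ln n%:R) `^ (1 - expR 1 * ln 3 / (2 * Num.sqrt 3) - eps) :> R].
Proof.
have [n1 h1] := complement_lower_bound R eps eps_gt0.
have [n2 h2] := complement_upper_bound R.
have [n3 h3] := ln_eventually_gt R 1.
exists (n1 + n2 + n3)%N => n hn.
have {}h3 := h3 n (leq_trans (leq_addl _ _) hn).
have hn12 := leq_trans (leq_addr _ _) hn.
split.
- have [A [A0 hA ->]] := F_attained n.
  exact: h1 (leq_trans (leq_addr _ _) hn12) A hA A0.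
- by rewrite lerD2l lerN2 ler_nat f_le_F.
- have [A [A0 hA bA]] := h2 n (leq_trans (leq_addl _ _) hn12).
  apply: (@le_lt_trans _ _ (n%:R - #|A|%:R)).
    by rewrite lerD2l lerN2 ler_nat card_le_f.
  apply: lt_le_trans bA _; apply: ler_wpM2l => //.
  have l0 : 0 < ln n%:R :> R by apply: lt_trans h3.
  (* Because [ln n > 1], the larger exponent [1 / 5] gives the smaller bound. *)
  rewrite lef_pV2 ?posrE ?powR_gt0 // ler_powR ?(ltW h3) //.
  by have := exponent_ge R; lra.
Qed.
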